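(* Consider the coupled SBP-SAT semi-discretization, with unknowns $u(t)\in\mathbb{R}^{nm}$ (finite difference block $\Omega_L$) and $v(t)\in\mathbb{R}^{N}$ (finite element block $\Omega_R$), $$u_t+\sum_{k=1}^2\Big[\mathcal{H}_L^{-1}\mathcal{Q}_{L,k}\,\alpha_kf_k(u)+\tilde\alpha_kF_k'(u)\,\mathcal{H}_L^{-1}\mathcal{Q}_{L,k}\,u\Big]=\mathcal{H}_L^{-1}\mathcal{R}_L^{(\epsilon)}u+\mathrm{SAT}_L+\mathrm{SAT}_{IL},$$ $$v_t+\sum_{k=1}^2\Big[\mathcal{H}_R^{-1}\mathcal{Q}_{R,k}\,\alpha_kf_k(v)+\tilde\alpha_kF_k'(v)\,\mathcal{H}_R^{-1}\mathcal{Q}_{R,k}\,v\Big]=\mathcal{H}_R^{-1}\mathcal{R}_R^{(\epsilon)}v+\mathrm{SAT}_R+\mathrm{SAT}_{IR},$$ with all operators as defined in the context, where the interface terms are $$\mathrm{SAT}_{IL}=\alpha_L(H_x^{-1}e_n)\otimes\big[(\alpha_1f_1(u))_I-I_{R2L}(\alpha_1f_1(v))_I\big]+\beta_L(H_x^{-1}e_n)\otimes\big[(\tilde\alpha_1F_1'(u))_I(u_I-I_{R2L}v_I)\big]$$ $$\qquad+\delta_L(H_x^{-1}e_n)\otimes\big[\mathcal{E}_L(\mathbf{D}_xu)_I-I_{R2L}\mathbf{D}_x^Wv\big]+\sigma_L(H_x^{-1}d_n^T)\otimes\big[\mathcal{E}_L(u_I-I_{R2L}v_I)\big],$$ $$\mathrm{SAT}_{IR}=\alpha_R\mathbf{M}^{-1}\mathbf{R}_M^WL_W^T\big[(\alpha_1f_1(v))_I-I_{L2R}(\alpha_1f_1(u))_I\big]+\beta_R\mathbf{M}^{-1}\big[\mathscr{R}_M^W(\tilde\alpha_1f_1'(v))\,v-\tilde\alpha_1F_1'(v)\,\mathbf{R}_M^WL_W^T\,I_{L2R}u_I\big]$$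 $$\qquad+\delta_R\mathbf{M}^{-1}\mathbf{R}_M^WL_W^T\big[\mathbf{D}_x^Wv-I_{L2R}\mathcal{E}_L(\mathbf{D}_xu)_I\big]+\sigma_R\mathbf{M}^{-1}(-\mathbf{R}_C^W)^TL_W^T\big[v_I-I_{L2R}u_I\big],$$ and $\{I_{L2R},I_{R2L}\}$ is a pair of SBP-preserving FD--FE interpolation operators. If $\alpha_L=\beta_L=\tfrac12$, $\alpha_R=\beta_R=-\tfrac12$, $\delta_L=-\sigma_R$, $\sigma_L=-\delta_R$ and $\delta_L+\sigma_L=-1$, then, assuming proper outer boundary treatment, the coupled approximation is stable: for zero boundary data, $\frac{d}{dt}\big(u^T\mathcal{H}_Lu+v^T\mathcal{H}_Rv\big)\le0$.
   Context: Continuous problem: $w_t+\nabla\cdot f(w)=\nabla\cdot(\epsilon\nabla w)$ on two adjoining rectangles $\Omega_L$ (left) and $\Omega_R$ (right) sharing the vertical interface $\Omega_I$, which is the whole East side of $\Omega_L$ and the whole West side $\Gamma_W$ of $\Omega_R$. Here $f=(f_1,f_2)^T$ with $f_1,f_2$ continuously differentiable functions of the conserved variable, $\epsilon=\epsilon(x,y)>0$ (possibly with different values on the two sides of $\Omega_I$), and the splitting weights $\alpha_1,\alpha_2$ are constants, $\tilde\alpha_k=1-\alpha_k$, with the skew-symmetry property $\alpha_kf_k(s)=\tilde\alpha_ks f_k'(s)$ for all $s$, $k=1,2$. For a vector $w$ of nodal values, $f_k(w)$ and $f_k'(w)$ are evaluated componentwise and $F_k'(w)=\mathrm{Diag}(f_k'(w))$.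 A subscript $I$ denotes the part belonging to the interface nodes. FD block. $\Omega_L$ carries an $n\times m$ equidistant grid $(x_i,y_j)$; vectors are ordered $(u_{1,1},\dots,u_{1,m},u_{2,1},\dots,u_{n,m})^T$. In one dimension, a diagonal-norm first derivative SBP operator is $D_1=H^{-1}Q$ with $H$ diagonal positive definite and $Q+Q^T=\mathrm{Diag}(-1,0,\dots,0,1)$; a second derivative SBP operator with variable coefficient $b>0$ and the same $H$ is $D_2^{(b)}=H^{-1}(-A^{(b)}-b_{1}e_1d_1+b_{\rm last}e_{\rm last}d_{\rm last})$ with $A^{(b)}=(A^{(b)})^T\ge0$, where $e_1,e_{\rm last}$ are the first and last unit column vectors and $d_1,d_{\rm last}$ are row vectors approximating the first derivative at the end points. The one-dimensional norms are $H_x$ (size $n$) and $H_y$ (size $m$). $\mathcal{H}_L=H_x\otimes H_y$; $\mathcal{H}_L^{-1}\mathcal{Q}_{L,1}=\mathbf{D}_x=D_1\otimes I_m$; $\mathcal{H}_L^{-1}\mathcal{Q}_{L,2}=\mathbf{D}_y=I_n\otimes D_1$; $\mathcal{H}_L^{-1}\mathcal{R}_L^{(\epsilon)}=\mathbf{D}_{2x}^{(\epsilon)}+\mathbf{D}_{2y}^{(\epsilon)}$, which apply $D_2^{(b)}$ along each grid line in $x$, respectively $y$, with $b$ the values of $\epsilon$ on that line. $u_I=(e_n^T\otimes I_m)u$, $(\mathbf{D}_xu)_I=(d_n\otimes I_m)u$, and $\mathcal{E}_L$ is the diagonal matrix of values of $\epsilon$ (from $\Omega_L$) at the FD grid points on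 $\Omega_I$. FE block. $\Omega_R$ carries a triangulation with $N$ vertices $x_i$ and continuous piecewise linear nodal Lagrange basis $\varphi_1,\dots,\varphi_N$. $\mathcal{H}_R=\mathbf{M}$ with $\mathbf{M}_{ij}=\int_{\Omega_R}\varphi_j\varphi_i$; $(\mathcal{Q}_{R,k})_{ij}=\int_{\Omega_R}(\partial_k\varphi_j)\varphi_i$ with $\partial_1=\partial_x$, $\partial_2=\partial_y$; $\mathcal{R}_R^{(\epsilon)}=-\mathbf{A}+\mathbf{R}_C^{\partial\Omega_R}$ with $\mathbf{A}_{ij}=\int_{\Omega_R}\epsilon\nabla\varphi_j\cdot\nabla\varphi_i$. For a side $\Gamma_s$, $s\in\{N,E,S,W\}$, of $\Omega_R$ with outward unit normal $n_s=(n_{s,1},n_{s,2})$: $(\mathbf{R}_M^s)_{ij}=\int_{\Gamma_s}\varphi_j\varphi_i\,ds$, $(\mathscr{R}_M^s(\phi))_{ij}=\int_{\Gamma_s}\phi\,\varphi_j\varphi_i\,ds$, $(\mathbf{R}_C^s)_{ij}=\int_{\Gamma_s}(n_s\cdot\epsilon\nabla\varphi_j)\varphi_i\,ds$, and $\mathbf{R}_C^{\partial\Omega_R}=\sum_s\mathbf{R}_C^s$. The weighted matrices $\mathscr{R}_M^s(\phi)$ are computed with a consistent quadrature rule, the same one in the scheme and in the coupling terms. The default rule is $\int_E\phi\varphi_j\varphi_i\,ds\approx\frac{\phi(x_i)+\phi(x_j)}2\int_E\varphi_j\varphi_i\,ds$ on each boundary edge $E$, which gives $\mathscr{R}_M^W(\phi)=\frac12(\mathbf{R}_M^W\Phi+\Phi\mathbf{R}_M^W)$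 with $\Phi=\mathrm{Diag}(\phi(x_1),\dots,\phi(x_N))$; with this rule the $\beta_R$-term is also used in the simplified form $\beta_R\mathbf{M}^{-1}\tilde\alpha_1F_1'(v)\mathbf{R}_M^WL_W^T[v_I-I_{L2R}u_I]$. $L_W$ is the binary matrix with exactly one $1$ in each row that selects the FE nodes on $\Gamma_W$, each once, in the same spatial order as the coupled FD interface values. $v_I=L_Wv$, $\mathbf{M}_I=L_W\mathbf{R}_M^WL_W^T$ (symmetric positive definite), $\mathbf{D}_x^W=-\mathbf{M}_I^{-1}L_W\mathbf{R}_C^W$. Interpolation. $I_{L2R}$ maps FD interface values to FE interface values and $I_{R2L}$ maps in the opposite direction; both are accurate of order $p$, the minimum of the boundary-closure orders of the two methods. The pair is called SBP-preserving FD--FE if $\mathbf{M}_II_{L2R}=I_{R2L}^TH_y$. Proper outer boundary treatment. $\mathrm{SAT}_L$ and $\mathrm{SAT}_R$ are the terms that weakly impose the boundary conditions on the outer sides (North, South, West of $\Omega_L$; North, East, South of $\Omega_R$). The treatment is proper if, for zero boundary data, all outer boundary terms in the energy estimate (the boundary terms that the SBP operators leave on the outer sides together with the contributions $2u^T\mathcal{H}_L\mathrm{SAT}_L$ and $2v^T\mathcal{H}_R\mathrm{SAT}_R$) sum to a nonpositive quantity.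
   Formalization: In the FE scheme the product F_k'(v)M^{-1}Q_{R,k}v is read as M^{-1}F_k'(v)Q_{R,k}v; the printed order, for which the estimate fails with nonlinear flux, is covered only when F_k'(v) commutes with M (as for linear flux). *)

(* Defs.v *)
From mathcomp Require Import all_boot all_order all_algebra.
From mathcomp Require Import mxtens.
From mathcomp Require Import all_classical all_reals all_analysis.

Set Implicit Arguments.
Unset Strict Implicit.
Unset Printing Implicit Defensive.
Import Order.TTheory GRing.Theory Num.Theory numFieldNormedType.Exports.

Local Open Scope classical_set_scope.
Local Open Scope ring_scope.

(* [A *t B] is the Kronecker product of matrices. *)

(* [Omega_L] = [xL, xI] x [yS, yN] and [Omega_R] = [xI, xE] x [yS, yN]. *)
Record blocks (R : realType) := Blocks {
  xL : R; xI : R; xE : R; yS : R; yN : R;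
  lt_xLI : xL < xI;
  lt_xIE : xI < xE;
  lt_ySN : yS < yN }.

Definition OmegaL (R : realType) (G : blocks R) : set (R * R) :=
  [set p | (xL G <= p.1 <= xI G) && (yS G <= p.2 <= yN G)].

Definition OmegaR (R : realType) (G : blocks R) : set (R * R) :=
  [set p | (xI G <= p.1 <= xE G) && (yS G <= p.2 <= yN G)].

(* The index [k : 'I_2] stands for the directions x (k = 0) and y (k = 1). *)
Definition evec (R : realType) (k : 'I_2) : R * R :=
  ((k == 0)%:R, (k == 1)%:R).

Definition int2 (R : realType) (D : set (R * R)) (g : R * R -> R) : R :=
  \int[(@lebesgue_measure R \x @lebesgue_measure R)%E]_(p in D) g p.

Definition integrable2 (R : realType) (D : set (R * R)) (g : R * R -> R) :=
  (@lebesgue_measure R \x @lebesgue_measure R)%E.-integrable D (EFin \o g).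

(* [epsL] and [epsR] are the values of the diffusion coefficient seen from the
   two sides of the interface, where they may differ.  The integrability of
   [epsR] only makes the entries of the FE stiffness matrix meaningful. *)
Record problem (R : realType) (G : blocks R) := Problem {
  flux : 'I_2 -> R -> R;
  alpha : 'I_2 -> R;
  epsL : R * R -> R;
  epsR : R * R -> R;
  flux_derivable : forall k s, derivable (flux k) s 1;
  flux_C1 : forall k, continuous (derive1 (flux k));
  flux_skew : forall k s,
    alpha k * flux k s = (1 - alpha k) * s * derive1 (flux k) s;
  epsL_gt0 : forall p, OmegaL G p -> 0 < epsL p;
  epsR_gt0 : forall p, OmegaR G p -> 0 < epsR p;
  epsR_int : integrable2 (OmegaR G) epsR }.

Section Flux.
Context {R : realType} {G : blocks R} (P : problem G).

Definition talpha (k : 'I_2) : R := 1 - alpha P k.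

Definition af (k : 'I_2) (q : nat) (w : 'cV[R]_q) : 'cV[R]_q :=
  alpha P k *: map_mx (flux P k) w.

Definition dF (k : 'I_2) (q : nat) (w : 'cV[R]_q) : 'M[R]_q :=
  diag_mx (map_mx (derive1 (flux P k)) w)^T.

End Flux.

(* Sizes are [n.+2] because an SBP grid has two distinct end points. *)
Definition grid (R : realType) (a b : R) (n : nat) : 'cV[R]_n.+2 :=
  \col_i (a + (b - a) * (i%:R / n.+1%:R)).

(* [sbpd0] and [sbpd1] are the row vectors d_1 and d_last; that they approximate
   the derivative at the end points is expressed by their being exact on the
   functions 1 and x.  [sbpA b] is the matrix A^(b) attached to the grid values
   [b] of the coefficient. *)
Record sbp1 (R : realType) (n : nat) (x : 'cV[R]_n.+2) := Sbp1 {
  sbph : 'rV[R]_n.+2;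
  sbpQ : 'M[R]_n.+2;
  sbpA : 'cV[R]_n.+2 -> 'M[R]_n.+2;
  sbpd0 : 'rV[R]_n.+2;
  sbpd1 : 'rV[R]_n.+2;
  sbph_gt0 : forall i, 0 < sbph 0 i;
  sbpQE : sbpQ + sbpQ^T = delta_mx ord_max ord_max - delta_mx ord0 ord0;
  sbpA_sym : forall b : 'cV[R]_n.+2, (forall i, 0 < b i 0) -> (sbpA b)^T = sbpA b;
  sbpA_ge0 : forall b : 'cV[R]_n.+2, (forall i, 0 < b i 0) ->
    forall z : 'cV[R]_n.+2, 0 <= (z^T *m sbpA b *m z) 0 0;
  sbpd0_1 : sbpd0 *m const_mx 1 = 0 :> 'cV[R]_1;
  sbpd1_1 : sbpd1 *m const_mx 1 = 0 :> 'cV[R]_1;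
  sbpd0_x : sbpd0 *m x = const_mx 1 :> 'cV[R]_1;
  sbpd1_x : sbpd1 *m x = const_mx 1 :> 'cV[R]_1 }.

Section Sbp1.
Context {R : realType} {n : nat} {x : 'cV[R]_n.+2} (S : sbp1 x).

Definition e_first : 'cV[R]_n.+2 := delta_mx ord0 0.
Definition e_last : 'cV[R]_n.+2 := delta_mx ord_max 0.

Definition sbpH : 'M[R]_n.+2 := diag_mx (sbph S).
Definition sbpD1 : 'M[R]_n.+2 := invmx sbpH *m sbpQ S.
Definition sbpD2 (b : 'cV[R]_n.+2) : 'M[R]_n.+2 :=
  invmx sbpH *m (- sbpA S b - b ord0 0 *: (e_first *m sbpd0 S)
                 + b ord_max 0 *: (e_last *m sbpd1 S)).

End Sbp1.

Record fd_block (R : realType) (G : blocks R) (n m : nat) := FdBlock {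
  Sx : sbp1 (grid (xL G) (xI G) n);
  Sy : sbp1 (grid (yS G) (yN G) m) }.

(* Grid functions are ordered (u_11, ..., u_1m, u_21, ..., u_nm). *)
Definition fdvec (R : realType) (n m : nat) := 'cV[R]_(n.+2 * m.+2).
Definition fdmx (R : realType) (n m : nat) := 'M[R]_(n.+2 * m.+2).

Section FD.
Context {R : realType} {G : blocks R} (P : problem G) {n m : nat}.
Context (B : fd_block G n m).

Let gx := grid (xL G) (xI G) n.
Let gy := grid (yS G) (yN G) m.
Let Hx := sbpH (Sx B).
Let Hy := sbpH (Sy B).

(* r (x) I_m and I_n (x) r for a row vector r: the results live on a grid line
   in the y, respectively x, direction. *)
Definition rowx (r : 'rV[R]_n.+2) : 'M[R]_(m.+2, n.+2 * m.+2) :=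
  castmx (mul1n _, erefl) (r *t (1%:M : 'M[R]_m.+2)).
Definition rowy (r : 'rV[R]_m.+2) : 'M[R]_(n.+2, n.+2 * m.+2) :=
  castmx (muln1 _, erefl) ((1%:M : 'M[R]_n.+2) *t r).

(* eps on the grid line number j in the x direction, number i in the y
   direction *)
Definition epsx (j : 'I_m.+2) : 'cV[R]_n.+2 := \col_i epsL P (gx i 0, gy j 0).
Definition epsy (i : 'I_n.+2) : 'cV[R]_m.+2 := \col_j epsL P (gx i 0, gy j 0).

Definition HL : fdmx R n m := Hx *t Hy.

Definition fdD (k : 'I_2) : fdmx R n m :=
  if k == 0 then sbpD1 (Sx B) *t (1%:M : 'M[R]_m.+2)
  else (1%:M : 'M[R]_n.+2) *t sbpD1 (Sy B).

Definition QL (k : 'I_2) : fdmx R n m := HL *m fdD k.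

Definition D2x : fdmx R n m :=
  \sum_(j < m.+2) sbpD2 (Sx B) (epsx j) *t (delta_mx j j : 'M[R]_m.+2).
Definition D2y : fdmx R n m :=
  \sum_(i < n.+2) (delta_mx i i : 'M[R]_n.+2) *t sbpD2 (Sy B) (epsy i).

Definition RL : fdmx R n m := HL *m (D2x + D2y).

(* u_I, (D_x u)_I and E_L *)
Definition fdI (u : fdvec R n m) : 'cV[R]_m.+2 := rowx e_last^T *m u.
Definition fdDI (u : fdvec R n m) : 'cV[R]_m.+2 := rowx (sbpd1 (Sx B)) *m u.
Definition EL : 'M[R]_m.+2 := diag_mx (epsy ord_max)^T.

(* 2 u^T H_L (H_L^-1 R_L u) and the convective terms leave on the West, North
   and South sides of Omega_L the terms
     - 2 sum_k n_k <u, alpha_k f_k(u)> + 2 <u, eps (n . D u)>,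
   with n the outward normal and < , > the one-dimensional discrete inner
   product of the side. *)
Definition fd_outer (u : fdvec R n m) : R :=
  let uW := rowx e_first^T *m u in
  let uS := rowy e_first^T *m u in
  let uN := rowy e_last^T *m u in
  let dW := diag_mx (epsy ord0)^T *m (rowx (sbpd0 (Sx B)) *m u) in
  let dS := diag_mx (epsx ord0)^T *m (rowy (sbpd0 (Sy B)) *m u) in
  let dN := diag_mx (epsx ord_max)^T *m (rowy (sbpd1 (Sy B)) *m u) in
  (uW^T *m Hy *m (2 *: af P 0 uW - 2 *: dW)) 0 0
  + (uS^T *m Hx *m (2 *: af P 1 uS - 2 *: dS)) 0 0
  + (uN^T *m Hx *m (2 *: dN - 2 *: af P 1 uN)) 0 0.

End FD.
Arguments EL {R G} P n m.


(* twice the signed area of the triangle p q r *)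
Definition cross (R : realType) (p q r : R * R) : R :=
  (q.1 - p.1) * (r.2 - p.2) - (r.1 - p.1) * (q.2 - p.2).

(* barycentric coordinate of p with respect to the vertex number a of the
   triangle X (indices a + 1 and a + 2 are modulo 3) *)
Definition bary (R : realType) (X : 'I_3 -> R * R) (a : 'I_3) (p : R * R) : R :=
  cross p (X (a + 1)) (X (a + 2)) / cross (X a) (X (a + 1)) (X (a + 2)).

(* A conforming triangulation of D with vertex set [vtx]: two triangles meet in
   the convex hull of their common vertices ([tri_conform]). *)
Record triangulation (R : realType) (N : nat) (D : set (R * R)) := Triangulation {
  vtx : 'I_N -> R * R;
  ntri : nat;
  tri : 'I_ntri -> 'I_3 -> 'I_N;
  corner := fun t a => vtx (tri t a);
  in_tri := fun t p => [forall a, 0 <= bary (corner t) a p];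
  vtx_inj : injective vtx;
  tri_nondeg : forall t, cross (corner t 0) (corner t 1) (corner t 2) != 0;
  tri_cover : forall p, D p <-> exists t, in_tri t p;
  tri_inj : injective (fun t => [set tri t a | a in 'I_3]%SET);
  tri_conform : forall s t p, in_tri s p -> in_tri t p ->
    forall a, tri s a \notin codom (tri t) -> bary (corner s) a p = 0;
  vtx_used : forall i, exists t a, tri t a = i }.

Section P1.
Context {R : realType} {N : nat} {D : set (R * R)} (T : triangulation N D).

(* the affine function (on the whole plane) which agrees with phi_j on t *)
Definition piece (t : 'I_(ntri T)) (j : 'I_N) (p : R * R) : R :=
  \sum_(a : 'I_3 | tri t a == j) bary (corner t) a p.

(* The nodal basis function phi_j, and its partial derivatives computed inside a
   triangle containing p.  The latter are unambiguous off the edges, and on a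
   side of the domain off the vertices. *)
Definition phi (j : 'I_N) (p : R * R) : R :=
  if [pick t : 'I_(ntri T) | in_tri t p] is Some t then piece t j p else 0.
Definition dphi (k : 'I_2) (j : 'I_N) (p : R * R) : R :=
  if [pick t : 'I_(ntri T) | in_tri t p] is Some t
  then 'D_(evec R k) (piece t j) p else 0.

End P1.

Inductive side := North | East | South | West.

Definition normal (R : realType) (s : side) (k : 'I_2) : R :=
  match s with
  | North => (k == 1)%:R
  | East  => (k == 0)%:R
  | South => - (k == 1)%:R
  | West  => - (k == 0)%:R
  end.

Definition side_int (R : realType) (G : blocks R) (s : side)
    (g : R * R -> R) : R :=
  match s with
  | North => \int[@lebesgue_measure R]_(x in `[xI G, xE G]) g (x, yN G)
  | East  => \int[@lebesgue_measure R]_(y in `[yS G, yN G]) g (xE G, y)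
  | South => \int[@lebesgue_measure R]_(x in `[xI G, xE G]) g (x, yS G)
  | West  => \int[@lebesgue_measure R]_(y in `[yS G, yN G]) g (xI G, y)
  end.

(* [west] lists the FE nodes on the West side, each once, from South to North:
   the order of the interface values of the FD block. *)
Record fe_block (R : realType) (G : blocks R) (N r : nat) := FeBlock {
  mesh : triangulation N (OmegaR G);
  west : 'I_r -> 'I_N;
  west_mem : forall i, (vtx mesh i).1 = xI G <-> exists a, west a = i;
  west_mono : forall a b : 'I_r, (a < b)%N ->
    (vtx mesh (west a)).2 < (vtx mesh (west b)).2 }.

(* Realizations of the product F_k'(v) (H_R^-1 Q_{R,k} v) in the FE scheme.
   [assembled]: the product is taken in the weak form, with nodal quadrature,
     \int f_k'(v) (d_k v) phi_i ~ f_k'(v_i) \int (d_k v) phi_i,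
   so that F_k'(v) acts on load vectors, as it does in the beta_R-term.
   [pointwise]: the nodal values of v_x, v_y are multiplied by f_k'(v). *)
Inductive fe_product := assembled | pointwise.

(* [simplified] drops the weighted matrix in favour of F_1'(v) R_M^W, which has
   the same quadratic form for the quadrature of [wRM] below. *)
Inductive beta_form := weighted | simplified.

Section FE.
Context {R : realType} {G : blocks R} (P : problem G) {N r : nat}.
Context (B : fe_block G N r).

Let T := mesh B.

Definition MR : 'M[R]_N :=
  \matrix_(i, j) int2 (OmegaR G) (fun p => phi T j p * phi T i p).

Definition QR (k : 'I_2) : 'M[R]_N :=
  \matrix_(i, j) int2 (OmegaR G) (fun p => dphi T k j p * phi T i p).

Definition AR : 'M[R]_N :=
  \matrix_(i, j) int2 (OmegaR G)
    (fun p => epsR P p * \sum_(k < 2) dphi T k j p * dphi T k i p).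

Definition RM (s : side) : 'M[R]_N :=
  \matrix_(i, j) side_int G s (fun p => phi T j p * phi T i p).

Definition RC (s : side) : 'M[R]_N :=
  \matrix_(i, j) side_int G s
    (fun p => (\sum_(k < 2) normal R s k * (epsR P p * dphi T k j p))
              * phi T i p).

(* The weighted boundary mass matrix for the quadrature
   (w_i + w_j) / 2 * \int_E phi_j phi_i  on each boundary edge E, where w is the
   vector of the nodal values of the weight. *)
Definition wRM (s : side) (w : 'cV[R]_N) : 'M[R]_N :=
  2^-1 *: (RM s *m diag_mx w^T + diag_mx w^T *m RM s).

Definition RR : 'M[R]_N := - AR + (RC North + RC East + RC South + RC West).

Definition LW : 'M[R]_(r, N) := \matrix_(a, i) (west B a == i)%:R.

(* v_I, M_I and D_x^W *)
Definition feI (v : 'cV[R]_N) : 'cV[R]_r := LW *m v.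
Definition MI : 'M[R]_r := LW *m RM West *m LW^T.
Definition DxW : 'M[R]_(r, N) := - (invmx MI *m LW *m RC West).

Definition fe_dF_prod (c : fe_product) (k : 'I_2) (v : 'cV[R]_N) : 'cV[R]_N :=
  match c with
  | assembled => invmx MR *m (dF P k v *m (QR k *m v))
  | pointwise => dF P k v *m (invmx MR *m (QR k *m v))
  end.

(* Same sign convention as [fd_outer]; the West side is the interface. *)
Definition fe_outer_side (s : side) (v : 'cV[R]_N) : R :=
  - 2 * \sum_(k < 2) normal R s k * (v^T *m RM s *m af P k v) 0 0
  + 2 * (v^T *m RC s *m v) 0 0.
Definition fe_outer (v : 'cV[R]_N) : R :=
  fe_outer_side North v + fe_outer_side East v + fe_outer_side South v.

End FE.

(* Accuracy of order p: exactness on the polynomials of degree < p. *)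
Definition accurate (R : realType) (p a b : nat) (I : 'M[R]_(b, a))
    (y : 'cV[R]_a) (z : 'cV[R]_b) : Prop :=
  forall q : nat, (q < p)%N ->
    I *m map_mx (fun s => s ^+ q) y = map_mx (fun s => s ^+ q) z.

Section Coupling.
Context {R : realType} {G : blocks R} (P : problem G) {n m N r : nat}.
Context (L : fd_block G n m) (E : fe_block G N r).
Context (IL2R : 'M[R]_(r, m.+2)) (IR2L : 'M[R]_(m.+2, r)).

Let Hx := sbpH (Sx L).

Definition fd_interface : 'cV[R]_m.+2 := grid (yS G) (yN G) m.
Definition fe_interface : 'cV[R]_r := \col_a (vtx (mesh E) (west E a)).2.

Definition sbp_preserving (p : nat) : Prop :=
  [/\ accurate p IL2R fd_interface fe_interface,
      accurate p IR2L fe_interface fd_interface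
    & MI E *m IL2R = IR2L^T *m sbpH (Sy L)].

Definition SAT_IL (aL bL dL sL : R) (u : fdvec R n m) (v : 'cV[R]_N) : fdvec R n m :=
  aL *: ((invmx Hx *m e_last)
         *t (fdI (af P 0 u) - IR2L *m feI E (af P 0 v)))
  + bL *: ((invmx Hx *m e_last)
           *t (talpha P 0 *: (dF P 0 (fdI u) *m (fdI u - IR2L *m feI E v))))
  + dL *: ((invmx Hx *m e_last)
           *t (EL P n m *m fdDI L u - IR2L *m (DxW P E *m v)))
  + sL *: ((invmx Hx *m (sbpd1 (Sx L))^T)
           *t (EL P n m *m (fdI u - IR2L *m feI E v))).

Definition beta_term (c : beta_form) (u : fdvec R n m) (v : 'cV[R]_N) : 'cV[R]_N :=
  match c with
  | weighted =>
      wRM E West (talpha P 0 *: map_mx (derive1 (flux P 0)) v) *m v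
      - talpha P 0 *: (dF P 0 v *m (RM E West *m (LW E)^T *m (IL2R *m fdI u)))
  | simplified =>
      talpha P 0 *: (dF P 0 v *m
        (RM E West *m (LW E)^T *m (feI E v - IL2R *m fdI u)))
  end.

Definition SAT_IR (c : beta_form) (aR bR dR sR : R) (u : fdvec R n m)
    (v : 'cV[R]_N) : 'cV[R]_N :=
  let lift := invmx (MR E) *m RM E West *m (LW E)^T in
  aR *: (lift *m (feI E (af P 0 v) - IL2R *m fdI (af P 0 u)))
  + bR *: (invmx (MR E) *m beta_term c u v)
  + dR *: (lift *m (DxW P E *m v - IL2R *m (EL P n m *m fdDI L u)))
  + sR *: (invmx (MR E) *m (- RC P E West)^T *m (LW E)^T
           *m (feI E v - IL2R *m fdI u)).

(* [SATL u] and [SATR v] are the outer penalties for zero boundary data. *)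
Definition proper_outer (SATL : fdvec R n m -> fdvec R n m)
    (SATR : 'cV[R]_N -> 'cV[R]_N) : Prop :=
  forall u v,
    (fd_outer P L u + 2 * (u^T *m HL L *m SATL u) 0 0)
    + (fe_outer P E v + 2 * (v^T *m MR E *m SATR v) 0 0) <= 0.

Definition energy (u : fdvec R n m) (v : 'cV[R]_N) : R :=
  (u^T *m HL L *m u) 0 0 + (v^T *m MR E *m v) 0 0.

End Coupling.

Definition derivable_at (R : realType) (q : nat) (w : R -> 'cV[R]_q) (t : R) :=
  forall i, derivable (fun s => w s i 0) t 1.

Definition ddt (R : realType) (q : nat) (w : R -> 'cV[R]_q) (t : R) : 'cV[R]_q :=
  \col_i derive1 (fun s => w s i 0) t.

(* Main.v *)
(* The energy method.  Multiplying the schemes by 2 u^T H_L and 2 v^T M, the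
   skew-symmetric splitting turns the convective terms into boundary terms,
   because Q + Q^T is a boundary form in both blocks; the diffusive terms leave
   a nonpositive volume part plus boundary terms.  With the given penalties the
   interface terms that stay within one block cancel, and the mixed ones cancel
   against those of the other block thanks to M_I I_L2R = I_R2L^T H_y.

   In the finite element block Q + Q^T is the boundary form by integration by
   parts: on every grid-parallel line containing no edge of the triangulation,
   a product of two nodal functions is continuous and smooth off finitely many
   points, so the fundamental theorem of calculus applies, and Fubini integrates
   over the lines.  Continuity across edges comes from conformity.  M and M_I are
   invertible because a finite element function with zero L^2 norm, on the
   domain or on the interface, vanishes at the nodes there. *)

Require Import Defs.
From mathcomp Require Import all_boot all_order all_algebra.
From mathcomp Require Import mxtens.
From mathcomp Require Import all_classical all_reals all_analysis.
From mathcomp Require Import measurable_realfun ring lra.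
Import Order.TTheory GRing.Theory Num.Theory numFieldNormedType.Exports.
Local Open Scope classical_set_scope.
Local Open Scope ring_scope.

(** * Discrete inner products, diagonal matrices and the split flux *)

Lemma ord2P (Q : 'I_2 -> Prop) : Q 0 -> Q 1 -> forall k, Q k.
Proof. by move=> Q0 Q1 [[|[|//]] i]; [move: Q0|move: Q1]; congr Q; apply: val_inj. Qed.

Lemma ord2D : (0%R + 1%R = 1%R :> 'I_2) * (1%R + 1%R = 0%R :> 'I_2).
Proof. by split; apply: val_inj. Qed.

Lemma sum2 (V : nmodType) (F : 'I_2 -> V) : \sum_k F k = F 0 + F 1.
Proof. by rewrite big_ord_recl big_ord1; congr (F _ + F _); apply: val_inj. Qed.

Definition dot {R : realType} {q : nat} (x y : 'cV[R]_q) : R := (x^T *m y) 0 0.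

Section Dot.
Context {R : realType}.

Lemma dotC q (x y : 'cV[R]_q) : dot x y = dot y x.
Proof. by rewrite /dot -[in LHS](trmxK y) -trmx_mul mxE. Qed.

Lemma dotMl q s (A : 'M[R]_(q, s)) x y : dot (A *m x) y = dot x (A^T *m y).
Proof. by rewrite /dot trmx_mul mulmxA. Qed.

Lemma dotMr q s (A : 'M[R]_(q, s)) x y : dot x (A *m y) = dot (A^T *m x) y.
Proof. by rewrite dotMl trmxK. Qed.

Lemma dotDr q (x y z : 'cV[R]_q) : dot x (y + z) = dot x y + dot x z.
Proof. by rewrite /dot mulmxDr mxE. Qed.

Lemma dotNr q (x y : 'cV[R]_q) : dot x (- y) = - dot x y.
Proof. by rewrite /dot mulmxN mxE. Qed.

Lemma dotBr q (x y z : 'cV[R]_q) : dot x (y - z) = dot x y - dot x z.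
Proof. by rewrite dotDr dotNr. Qed.

Lemma dotZr q (c : R) (x y : 'cV[R]_q) : dot x (c *: y) = c * dot x y.
Proof. by rewrite /dot -scalemxAr mxE. Qed.

Lemma dotZl q (c : R) (x y : 'cV[R]_q) : dot (c *: x) y = c * dot x y.
Proof. by rewrite dotC dotZr dotC. Qed.

Lemma dot_sumr q (I : finType) (x : 'cV[R]_q) (F : I -> 'cV[R]_q) :
  dot x (\sum_i F i) = \sum_i dot x (F i).
Proof. by rewrite /dot mulmx_sumr summxE. Qed.

Lemma dotE q (x y : 'cV[R]_q) : dot x y = \sum_i x i 0 * y i 0.
Proof. by rewrite /dot mxE; apply: eq_bigr => i _; rewrite mxE. Qed.

Lemma formE q s (A : 'M[R]_(q, s)) x y : (x^T *m A *m y) 0 0 = dot x (A *m y).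
Proof. by rewrite /dot mulmxA. Qed.

End Dot.

Section Diag.
Context {R : realType}.

Lemma diag_mx_unit q (h : 'rV[R]_q) :
  (forall i, 0 < h 0 i) -> diag_mx h \in unitmx.
Proof.
move=> h0; rewrite unitmxE det_diag unitfE; apply/prodf_neq0 => i _.
by rewrite gt_eqF.
Qed.

(** Makes [HL] a diagonal matrix, hence symmetric and commuting with every [dF P k u]. *)
Lemma tens_diag_mx q s (a : 'rV[R]_q) (b : 'rV[R]_s) :
  exists c, diag_mx a *t diag_mx b = diag_mx c.
Proof.
exists (\row_i (a 0 (mxtens_unindex i).1 * b 0 (mxtens_unindex i).2)).
apply/matrixP => i j.
case: (mxtens_indexP i) => i1 i2; case: (mxtens_indexP j) => j1 j2.
rewrite tensmxE !mxE mxtens_indexK /=.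
rewrite (can_eq (@mxtens_indexK _ _)) xpair_eqE.
by case: eqP => _; case: eqP => _; rewrite ?mulr0 ?mul0r.
Qed.

End Diag.

Section Flux.
Context {R : realType} {G : blocks R} (P : problem G).

(** The skew-symmetry hypothesis [flux_skew], read at each node. *)
Lemma talpha_dF k q (w : 'cV[R]_q) : talpha P k *: (dF P k w *m w) = af P k w.
Proof.
apply/matrixP => i j; rewrite ord1 mul_diag_mx !mxE flux_skew /talpha.
by rewrite -mulrA (mulrC (w i 0)).
Qed.

(** The diagonal matrix [dF] moves onto [w], where skew-symmetry turns it into the flux. The
    nonconservative half of the splitting thus becomes the transpose of the conservative half, which
    is how [Q + Q^T] arises. *)
Lemma af_dF k q (w z : 'cV[R]_q) (A : 'M[R]_q) :
  talpha P k * dot w (dF P k w *m (A *m z)) = dot (af P k w) (A *m z).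
Proof. by rewrite dotMr tr_diag_mx -dotZl talpha_dF. Qed.

Lemma af_mul k q s (f : 'I_s -> 'I_q) (w : 'cV[R]_q) :
  af P k (\col_i w (f i) 0) = \col_i af P k w (f i) 0.
Proof. by apply/matrixP => i j; rewrite !mxE. Qed.

End Flux.

(** * The finite difference block *)

Section Tens.
Context {R : realType} {n m : nat}.
Local Notation rowx := (@rowx R n m).
Local Notation rowy := (@rowy R n m).

Lemma rowxE (r : 'rV[R]_n.+2) j i k :
  rowx r j (mxtens_index (i, k)) = r 0 i * (j == k)%:R.
Proof.
rewrite /rowx castmxE /= cast_ord_id.
have -> : cast_ord (esym (mul1n m.+2)) j = mxtens_index (0 : 'I_1, j).
  by apply: val_inj.
by rewrite tensmxE mxE.
Qed.

Lemma rowyE (r : 'rV[R]_m.+2) j i k :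
  rowy r j (mxtens_index (i, k)) = (j == i)%:R * r 0 k.
Proof.
rewrite /rowy castmxE /= cast_ord_id.
have -> : cast_ord (esym (muln1 n.+2)) j = mxtens_index (j, 0 : 'I_1).
  by apply: val_inj; rewrite /= muln1 addn0.
by rewrite tensmxE mxE.
Qed.

Lemma rowx_delta i (w : 'cV[R]_(n.+2 * m.+2)) :
  rowx (delta_mx 0 i) *m w = \col_j w (mxtens_index (i, j)) 0.
Proof.
apply/matrixP => j k; rewrite ord1 !mxE (bigD1 (mxtens_index (i, j))) //=.
rewrite rowxE mxE !eqxx mul1r mul1r big1 ?addr0 // => l.
case: (mxtens_indexP l) => a b; rewrite rowxE mxE eqxx /=.
rewrite (can_eq (@mxtens_indexK _ _)) xpair_eqE [j == b]eq_sym.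
by case: (a == i); case: (b == j) => // _; rewrite ?mulr0 ?mul0r.
Qed.

Lemma rowy_delta i (w : 'cV[R]_(n.+2 * m.+2)) :
  rowy (delta_mx 0 i) *m w = \col_j w (mxtens_index (j, i)) 0.
Proof.
apply/matrixP => j k; rewrite ord1 !mxE (bigD1 (mxtens_index (j, i))) //=.
rewrite rowyE mxE !eqxx mul1r mul1r big1 ?addr0 // => l.
case: (mxtens_indexP l) => a b; rewrite rowyE mxE eqxx /=.
rewrite (can_eq (@mxtens_indexK _ _)) xpair_eqE [j == a]eq_sym.
by case: (a == j); case: (b == i) => // _; rewrite ?mulr0 ?mul0r.
Qed.

Lemma rowxT_mul p (c : 'cV[R]_n.+2) (B : 'M[R]_(m.+2, p)) i j k :
  ((rowx c^T)^T *m B) (mxtens_index (i, j)) k = c i 0 * B j k.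
Proof.
rewrite mxE (bigD1 j) //= big1 => [|l /negPf lj].
  by rewrite mxE rowxE mxE eqxx mulr1 addr0.
by rewrite mxE rowxE lj mulr0 mul0r.
Qed.

Lemma rowyT_mul p (c : 'cV[R]_m.+2) (B : 'M[R]_(n.+2, p)) i j k :
  ((rowy c^T)^T *m B) (mxtens_index (i, j)) k = c j 0 * B i k.
Proof.
rewrite mxE (bigD1 i) //= big1 => [|l /negPf lj].
  by rewrite mxE rowyE mxE eqxx mul1r addr0.
by rewrite mxE rowyE lj !mul0r.
Qed.

(** Presents a penalty lifted from a grid line as a transposed row extraction, so that its inner
    product with [u] becomes one on that line. *)
Lemma tens_col (c : 'cV[R]_n.+2) (q : 'cV[R]_m.+2) :
  c *t q = (rowx c^T)^T *m q.
Proof.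
apply/matrixP => i k; case: (mxtens_indexP i) => a b.
by rewrite ord1 rowxT_mul mxE mxtens_indexK /= !ord1.
Qed.

Lemma mul_rowx p (B : 'M[R]_(p, m.+2)) (d : 'rV[R]_n.+2) k i j :
  (B *m rowx d) k (mxtens_index (i, j)) = d 0 i * B k j.
Proof.
rewrite mxE (bigD1 j) //= big1 => [|l /negPf lj].
  by rewrite rowxE eqxx mulr1 addr0 mulrC.
by rewrite rowxE lj !mulr0.
Qed.

Lemma mul_rowy p (B : 'M[R]_(p, n.+2)) (d : 'rV[R]_m.+2) k i j :
  (B *m rowy d) k (mxtens_index (i, j)) = d 0 j * B k i.
Proof.
rewrite mxE (bigD1 i) //= big1 => [|l /negPf lj].
  by rewrite rowyE eqxx mul1r addr0 mulrC.
by rewrite rowyE lj mul0r mulr0.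
Qed.

(** The boundary parts of the SBP operators are of rank one in the normal direction; such a matrix
    factors through the grid line on which the boundary term lives. *)
Lemma tens_rankx (c : 'cV[R]_n.+2) (d : 'rV[R]_n.+2) (B : 'M[R]_m.+2) :
  (c *m d) *t B = (rowx c^T)^T *m (B *m rowx d).
Proof.
apply/matrixP => i j; case: (mxtens_indexP i) => a b.
case: (mxtens_indexP j) => a' b'.
by rewrite tensmxE rowxT_mul mul_rowx mxE big_ord1 mulrA.
Qed.

Lemma tens_ranky (c : 'cV[R]_m.+2) (d : 'rV[R]_m.+2) (A : 'M[R]_n.+2) :
  A *t (c *m d) = (rowy c^T)^T *m (A *m rowy d).
Proof.
apply/matrixP => i j; case: (mxtens_indexP i) => a b.
case: (mxtens_indexP j) => a' b'.
rewrite tensmxE rowyT_mul mul_rowy mxE big_ord1.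
ring.
Qed.

End Tens.

Section TensLinear.
Context {R : realType}.

Lemma tensmxDl m n p q (A A' : 'M[R]_(m, n)) (B : 'M[R]_(p, q)) :
  (A + A') *t B = A *t B + A' *t B.
Proof. by apply/matrixP => i j; rewrite !mxE mulrDl. Qed.

Lemma tensmxDr m n p q (A : 'M[R]_(m, n)) (B B' : 'M[R]_(p, q)) :
  A *t (B + B') = A *t B + A *t B'.
Proof. by apply/matrixP => i j; rewrite !mxE mulrDr. Qed.

Lemma tensmxZl m n p q c (A : 'M[R]_(m, n)) (B : 'M[R]_(p, q)) :
  (c *: A) *t B = c *: (A *t B).
Proof. by apply/matrixP => i j; rewrite !mxE mulrA. Qed.

Lemma tensmxZr m n p q c (A : 'M[R]_(m, n)) (B : 'M[R]_(p, q)) :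
  A *t (c *: B) = c *: (A *t B).
Proof. by apply/matrixP => i j; rewrite !mxE mulrCA. Qed.

Lemma tensmxNl m n p q (A : 'M[R]_(m, n)) (B : 'M[R]_(p, q)) :
  (- A) *t B = - (A *t B).
Proof. by rewrite -scaleN1r tensmxZl scaleN1r. Qed.

Lemma tensmxNr m n p q (A : 'M[R]_(m, n)) (B : 'M[R]_(p, q)) :
  A *t (- B) = - (A *t B).
Proof. by rewrite -scaleN1r tensmxZr scaleN1r. Qed.

Lemma dot_rankx n m (u w : 'cV[R]_(n.+2 * m.+2)) c (d : 'rV[R]_n.+2) B :
  dot u ((c *m d) *t B *m w) = dot (rowx c^T *m u) (B *m (rowx d *m w)).
Proof. by rewrite tens_rankx -!mulmxA dotMl. Qed.

Lemma dot_ranky n m (u w : 'cV[R]_(n.+2 * m.+2)) c (d : 'rV[R]_m.+2) A :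
  dot u (A *t (c *m d) *m w) = dot (rowy c^T *m u) (A *m (rowy d *m w)).
Proof. by rewrite tens_ranky -!mulmxA dotMl. Qed.

Lemma delta_mx_rank1 q (i : 'I_q) :
  delta_mx i i = (delta_mx i 0 : 'cV[R]_q) *m (delta_mx i 0)^T.
Proof. by rewrite trmx_delta mul_delta_mx. Qed.

Lemma diag_mul_delta q (d : 'rV[R]_q) i :
  diag_mx d *m delta_mx i i = d 0 i *: delta_mx i i.
Proof.
apply/matrixP => j k; rewrite mul_diag_mx !mxE.
by case: eqP => [->|]; rewrite ?mulr0.
Qed.

End TensLinear.

(** * Energy contributions of convection and diffusion on the grid *)

Section FDEnergy.
Context {R : realType} {G : blocks R} (P : problem G) {n m : nat}.
Context (B : fd_block G n m).

Local Notation Hx := (sbpH (Sx B)).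
Local Notation Hy := (sbpH (Sy B)).
Local Notation HL := (HL B).

Lemma sbpH_unit k (x : 'cV[R]_k.+2) (S : sbp1 x) : sbpH S \in unitmx.
Proof. exact/diag_mx_unit/sbph_gt0. Qed.

Lemma sbpH_tr k (x : 'cV[R]_k.+2) (S : sbp1 x) : (sbpH S)^T = sbpH S.
Proof. exact: tr_diag_mx. Qed.

Lemma HL_diag : exists c, HL = diag_mx c.
Proof. exact: tens_diag_mx. Qed.

Lemma HL_tr : HL^T = HL.
Proof. by have [c ->] := HL_diag; rewrite tr_diag_mx. Qed.

Lemma HL_unit : HL \in unitmx.
Proof. by apply: tensmx_unit => //; exact: sbpH_unit. Qed.

Lemma QL_x : QL B 0 = sbpQ (Sx B) *t Hy.
Proof.
by rewrite /QL /fdD eqxx tensmx_mul mulmx1 /sbpD1 mulKVmx ?sbpH_unit.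
Qed.

Lemma QL_y : QL B 1 = Hx *t sbpQ (Sy B).
Proof.
by rewrite /QL /fdD /= tensmx_mul mulmx1 /sbpD1 mulKVmx ?sbpH_unit.
Qed.

Lemma rowx_af (r : 'I_n.+2) k (u : fdvec R n m) :
  rowx (delta_mx r 0)^T *m af P k u = af P k (rowx (delta_mx r 0)^T *m u).
Proof. by rewrite trmx_delta !rowx_delta af_mul. Qed.

Lemma rowy_af (r : 'I_m.+2) k (u : fdvec R n m) :
  rowy (delta_mx r 0)^T *m af P k u = af P k (rowy (delta_mx r 0)^T *m u).
Proof. by rewrite trmx_delta !rowy_delta af_mul. Qed.

(** By [af_dF], each direction contributes only the form of [Q + Q^T], which [sbpQE] reduces to rank
    one terms on the two end lines. *)
Lemma fd_convection (u : fdvec R n m) :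
  dot u (HL *m \sum_(k < 2)
     (invmx HL *m QL B k *m af P k u
      + talpha P k *: (dF P k u *m (invmx HL *m QL B k *m u))))
  = dot (fdI u) (Hy *m fdI (af P 0 u))
    - dot (rowx e_first^T *m u) (Hy *m af P 0 (rowx e_first^T *m u))
    + dot (rowy e_last^T *m u) (Hx *m af P 1 (rowy e_last^T *m u))
    - dot (rowy e_first^T *m u) (Hx *m af P 1 (rowy e_first^T *m u)).
Proof.
have conv k : dot u (HL *m (invmx HL *m QL B k *m af P k u
      + talpha P k *: (dF P k u *m (invmx HL *m QL B k *m u))))
    = dot u ((QL B k + (QL B k)^T) *m af P k u).
  have -> : HL *m (invmx HL *m QL B k *m af P k u + talpha P k *:
        (dF P k u *m (invmx HL *m QL B k *m u)))
      = QL B k *m af P k u + talpha P k *: (dF P k u *m (QL B k *m u)).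
    (* Both [HL] and [dF] are diagonal, so they commute and the norm cancels its inverse in the
       nonconservative half too. *)
    have [c HLE] := HL_diag.
    have HdF : HL *m dF P k u = dF P k u *m HL.
      by rewrite HLE /dF !mulmx_diag; congr diag_mx; apply/rowP => j; rewrite !mxE mulrC.
    rewrite mulmxDr -[HL *m (talpha _ _ *: _)]scalemxAr [HL *m (dF _ _ _ *m _)]mulmxA HdF -!mulmxA.
    by rewrite !mulKVmx ?HL_unit.
  rewrite dotDr dotZr.
  by rewrite af_dF mulmxDl dotDr [dot (af _ _ _) _]dotC dotMl.
rewrite mulmx_sumr dot_sumr sum2 !conv QL_x QL_y !trmx_tens !sbpH_tr -tensmxDl -tensmxDr !sbpQE.
rewrite tensmxDl tensmxNl tensmxDr tensmxNr !mulmxBl !dotBr !delta_mx_rank1.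
by rewrite !dot_rankx !dot_ranky !rowx_af !rowy_af /fdI rowx_af addrA.
Qed.

(** The end values of [epsx j] are rewritten as values of [epsy] on the two end columns, so that the
    sum over [j] assembles the diagonal coefficient matrices of the West and East sides. *)
Lemma HL_sbpD2x (j : 'I_m.+2) :
  HL *m (sbpD2 (Sx B) (@epsx _ _ P n m j) *t (delta_mx j j : 'M[R]_m.+2)) =
  - (sbph (Sy B) 0 j *: (sbpA (Sx B) (@epsx _ _ P n m j) *t (delta_mx j j : 'M[R]_m.+2)))
  - ((e_first : 'cV[R]_n.+2) *m sbpd0 (Sx B)) *t (Hy *m (@epsy _ _ P n m ord0 j 0 *: delta_mx j j))
  + (e_last *m sbpd1 (Sx B)) *t (Hy *m (@epsy _ _ P n m ord_max j 0 *: delta_mx j j)).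
Proof.
rewrite tensmx_mul /sbpD2 mulKVmx ?sbpH_unit // -!scalemxAr !tensmxZr.
rewrite !diag_mul_delta !tensmxZr !tensmxDl !tensmxNl !tensmxZl.
rewrite !scalerDr !scalerN !scalerA !(mulrC (sbph _ _ _)).
by rewrite /epsx /epsy !mxE.
Qed.

Lemma HL_sbpD2y (i : 'I_n.+2) :
  HL *m ((delta_mx i i : 'M[R]_n.+2) *t sbpD2 (Sy B) (@epsy _ _ P n m i)) =
  - (sbph (Sx B) 0 i *: ((delta_mx i i : 'M[R]_n.+2) *t sbpA (Sy B) (@epsy _ _ P n m i)))
  - (Hx *m (@epsx _ _ P n m ord0 i 0 *: delta_mx i i)) *t (e_first *m sbpd0 (Sy B))
  + (Hx *m (@epsx _ _ P n m ord_max i 0 *: delta_mx i i)) *t (e_last *m sbpd1 (Sy B)).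
Proof.
rewrite tensmx_mul /sbpD2 mulKVmx ?sbpH_unit // -!scalemxAr !tensmxZl.
rewrite !diag_mul_delta !tensmxZl !tensmxDr !tensmxNr !tensmxZr.
rewrite !scalerDr !scalerN !scalerA !(mulrC (sbph _ _ _)).
by rewrite /epsx /epsy !mxE.
Qed.

Lemma grid_itv (a b : R) k (i : 'I_k.+2) : a < b -> a <= grid a b k i 0 <= b.
Proof.
move=> ab; rewrite mxE.
have q0 : 0 <= i%:R / k.+1%:R :> R by rewrite divr_ge0.
have q1 : i%:R / k.+1%:R <= 1 :> R.
  by rewrite ler_pdivrMr ?ltr0n // mul1r ler_nat -ltnS.
move: (_ / _) q0 q1 => q q0 q1.
have := mulr_ge0 (ltW (_ : 0 < b - a)) q0; rewrite subr_gt0 => /(_ ab) ?.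
have : 0 <= (b - a) * (1 - q) by rewrite mulr_ge0 ?subr_ge0 // ltW.
by move=> ?; apply/andP; split; lra.
Qed.

Lemma epsx_gt0 (j : 'I_m.+2) (i : 'I_n.+2) : 0 < @epsx _ _ P n m j i 0.
Proof.
rewrite mxE; apply: epsL_gt0; rewrite /OmegaL /=.
by rewrite !grid_itv ?lt_xLI ?lt_ySN.
Qed.

Lemma epsy_gt0 (i : 'I_n.+2) (j : 'I_m.+2) : 0 < @epsy _ _ P n m i j 0.
Proof. by have := epsx_gt0 j i; rewrite !mxE. Qed.

Lemma sum_diag_delta q (d : 'cV[R]_q) : \sum_j d j 0 *: delta_mx j j = diag_mx d^T.
Proof. by rewrite diag_mx_sum_delta; apply: eq_bigr => j _; rewrite mxE. Qed.

(** An inequality, since the dissipative volume terms are dropped: each [sbpA] is positive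
    semidefinite for the positive coefficient values on its grid line. *)
Lemma fd_diffusion (u : fdvec R n m) :
  dot u (RL P B *m u) <=
    dot (fdI u) (Hy *m (EL P n m *m fdDI B u))
    - dot (rowx e_first^T *m u)
        (Hy *m (diag_mx (@epsy _ _ P n m ord0)^T *m (rowx (sbpd0 (Sx B)) *m u)))
    + dot (rowy e_last^T *m u)
        (Hx *m (diag_mx (@epsx _ _ P n m ord_max)^T *m (rowy (sbpd1 (Sy B)) *m u)))
    - dot (rowy e_first^T *m u)
        (Hx *m (diag_mx (@epsx _ _ P n m ord0)^T *m (rowy (sbpd0 (Sy B)) *m u))).
Proof.
have tens_sumr k l (A : 'M[R]_k) (F : 'I_l -> 'M[R]_l) :
    \sum_j A *t F j = A *t (\sum_j F j).
  apply/matrixP => i j; rewrite summxE !mxE summxE mulr_sumr.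
  by apply: eq_bigr => c _; rewrite mxE.
have tens_suml k l (A : 'M[R]_k) (F : 'I_l -> 'M[R]_l) :
    \sum_j F j *t A = (\sum_j F j) *t A.
  apply/matrixP => i j; rewrite summxE !mxE summxE mulr_suml.
  by apply: eq_bigr => c _; rewrite mxE.
rewrite /RL mulmxDr mulmxDl dotDr /D2x /D2y !mulmx_sumr.
rewrite (eq_bigr _ (fun j _ => HL_sbpD2x j)) (eq_bigr _ (fun i _ => HL_sbpD2y i)).
rewrite !big_split /= !tens_sumr !tens_suml -!mulmx_sumr !sumrN !tens_sumr !tens_suml.
rewrite -!mulmx_sumr !sum_diag_delta.
rewrite !mulmxDl !dotDr !mulNmx !dotNr !dot_rankx !dot_ranky -!mulmxA.
rewrite -/(EL P n m).
(* The factor [delta_mx j j] has rank one, so each summand is a positive weight times the quadratic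
   form of [sbpA] on the restriction of [u] to one grid line. *)
have dx : 0 <= dot u ((\sum_j sbph (Sy B) 0 j *: (sbpA (Sx B) (@epsx _ _ P n m j)
    *t (delta_mx j j : 'M[R]_m.+2))) *m u).
  rewrite mulmx_suml dot_sumr sumr_ge0 // => j _.
  rewrite -scalemxAl dotZr mulr_ge0 //; first exact/ltW/sbph_gt0.
  rewrite delta_mx_rank1 dot_ranky -formE.
  by apply: sbpA_ge0 => i; exact: epsx_gt0.
have dy : 0 <= dot u ((\sum_i sbph (Sx B) 0 i *: ((delta_mx i i : 'M[R]_n.+2)
    *t sbpA (Sy B) (@epsy _ _ P n m i))) *m u).
  rewrite mulmx_suml dot_sumr sumr_ge0 // => i _.
  rewrite -scalemxAl dotZr mulr_ge0 //; first exact/ltW/sbph_gt0.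
  rewrite delta_mx_rank1 dot_rankx -formE.
  by apply: sbpA_ge0 => j; exact: epsy_gt0.
rewrite /fdI /fdDI.
lra.
Qed.

End FDEnergy.

(** * Triangulations and nodal functions *)

Section Barycentric.
Context {R : realType}.

Lemma ord3P (Q : 'I_3 -> Prop) : Q 0 -> Q 1 -> Q 2 -> forall a, Q a.
Proof.
move=> Q0 Q1 Q2 [[|[|[|//]]] i]; [move: Q0|move: Q1|move: Q2];
  by congr Q; apply: val_inj.
Qed.

Lemma sum3 (F : 'I_3 -> R) : \sum_a F a = F 0 + F 1 + F 2.
Proof.
rewrite !big_ord_recl big_ord0 addr0 addrA.
by congr (F _ + F _ + F _); apply: val_inj.
Qed.

Lemma ord3D : (0%R + 1%R = 1%R :> 'I_3) * (0%R + 2%R = 2%R :> 'I_3)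
 * (1%R + 1%R = 2%R :> 'I_3) * (1%R + 2%R = 0%R :> 'I_3)
 * (2%R + 1%R = 0%R :> 'I_3) * (2%R + 2%R = 1%R :> 'I_3).
Proof. by do !split; apply: val_inj. Qed.

Implicit Types (X : 'I_3 -> R * R) (p : R * R).

Definition area2 X := cross (X 0) (X 1) (X 2).

Definition bary_grad X (a : 'I_3) (k : 'I_2) : R :=
  (if k == 0 then (X (a + 1)).2 - (X (a + 2)).2
   else (X (a + 2)).1 - (X (a + 1)).1) / area2 X.

Lemma cross_cyclic X a : cross (X a) (X (a + 1)) (X (a + 2)) = area2 X.
Proof. by elim/ord3P: a; rewrite !ord3D /area2 /cross //; ring. Qed.

Lemma baryE X a p :
  bary X a p = cross 0 (X (a + 1)) (X (a + 2)) / area2 X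
               + bary_grad X a 0 * p.1 + bary_grad X a 1 * p.2.
Proof. by rewrite /bary cross_cyclic /bary_grad /cross /=; ring. Qed.

(** Affine functions are their own Lagrange interpolants on a nondegenerate triangle; in coordinates
    this is a rational identity with denominator [area2 X]. *)
Lemma affine_bary (g : R * R -> R) X c0 c1 c2 p : area2 X != 0 ->
  (forall q, g q = c0 + c1 * q.1 + c2 * q.2) ->
  g p = \sum_a bary X a p * g (X a).
Proof.
move=> X0 gE; rewrite sum3 !gE /bary !cross_cyclic !ord3D.
by move: X0; rewrite /area2 /cross => X0; field.
Qed.

Lemma bary_vertex X a b : area2 X != 0 -> bary X a (X b) = (a == b)%:R.
Proof.
rewrite /bary cross_cyclic /area2 /cross => X0.
elim/ord3P: a; elim/ord3P: b; rewrite !ord3D /=; field; exact: X0.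
Qed.

Lemma sum_bary X p : area2 X != 0 -> \sum_a bary X a p = 1.
Proof.
move=> X0; rewrite [RHS](affine_bary (fun=> 1) X 1 0 0 p X0); last by move=> q; ring.
by apply: eq_bigr => a _; rewrite mulr1.
Qed.

(** With a zero gradient the coordinate would be constant, yet it is 1 at its own vertex and 0 at
    the next one. *)
Lemma bary_grad_neq0 X a : area2 X != 0 -> bary_grad X a 0 = 0 -> bary_grad X a 1 != 0.
Proof.
move=> X0 g0; apply/negP => /eqP g1.
have : bary X a (X a) - bary X a (X (a + 1)) = 0.
  by rewrite !baryE g0 g1; ring.
rewrite !bary_vertex // eqxx; elim/ord3P: a {g0 g1} => /=;
  by rewrite ?ord3D /= subr0 => /eqP; rewrite oner_eq0.
Qed.

End Barycentric.

Section Nodal.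
Context {R : realType} {N : nat} {D : set (R * R)} (T : triangulation N D).
Implicit Types (p : R * R) (s t : 'I_(ntri T)) (j : 'I_N).

Lemma area2_corner (t : 'I_(ntri T)) : area2 (corner t) != 0.
Proof. exact: tri_nondeg. Qed.

Lemma piece_sum (t : 'I_(ntri T)) j p :
  piece t j p = \sum_a (tri t a == j)%:R * bary (corner t) a p.
Proof.
rewrite /piece big_mkcond /=; apply: eq_bigr => a _.
by case: eqP => _; rewrite ?mul1r ?mul0r.
Qed.

Lemma piece_vertex (t : 'I_(ntri T)) j a : piece t j (vtx T (tri t a)) = (tri t a == j)%:R.
Proof.
rewrite piece_sum (bigD1 a) //= big1 => [|b /negPf ba].
  by rewrite bary_vertex ?area2_corner // eqxx mulr1 addr0.
by rewrite bary_vertex ?area2_corner // ba mulr0.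
Qed.

Definition pgrad (t : 'I_(ntri T)) j (k : 'I_2) : R :=
  \sum_(a | tri t a == j) bary_grad (corner t) a k.

Lemma pieceE (t : 'I_(ntri T)) j p : piece t j p =
  piece t j 0 + pgrad t j 0 * p.1 + pgrad t j 1 * p.2.
Proof.
rewrite /piece /pgrad !mulr_suml -!big_split /=; apply: eq_bigr => a _.
by rewrite baryE [in RHS]baryE /=; ring.
Qed.

(** Expand the piece of [t] in the barycentric coordinates of [s]. At a shared vertex it has the
    right nodal value; at any other vertex of [s] the coordinate of [p] is zero by conformity. Hence
    [phi] does not depend on the triangle picked. *)
Lemma piece_agree (s t : 'I_(ntri T)) j p :
  in_tri s p -> in_tri t p -> piece s j p = piece t j p.
Proof.
move=> sp tp; rewrite (affine_bary (piece t j) (corner s) _ _ _ p (area2_corner s) (pieceE t j)).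
rewrite piece_sum; apply: eq_bigr => a _; rewrite mulrC.
case: (boolP (tri s a \in codom (tri t))) => [/codomP[b sa]|sa].
  by rewrite [corner s a]/corner sa piece_vertex.
by rewrite (tri_conform sp tp sa) !mul0r.
Qed.

Lemma phi_piece (t : 'I_(ntri T)) j p : in_tri t p -> phi T j p = piece t j p.
Proof.
rewrite /phi => tp; case: pickP => [s sp|/(_ t)]; last by rewrite tp.
exact: piece_agree.
Qed.

Lemma in_tri_vertex (t : 'I_(ntri T)) a : in_tri t (vtx T (tri t a)).
Proof. by apply/forallP => b; rewrite bary_vertex ?area2_corner ?ler0n. Qed.

Lemma vtx_dom i : D (vtx T i).
Proof.
by have [t [a <-]] := vtx_used T i; apply/(tri_cover T); exists t; exact: in_tri_vertex.
Qed.

Lemma phi_vertex i j : phi T j (vtx T i) = (i == j)%:R.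
Proof.
have [t [a <-]] := vtx_used T i.
by rewrite (phi_piece t) ?in_tri_vertex // piece_vertex.
Qed.

Lemma phi_itv j p : 0 <= phi T j p <= 1.
Proof.
rewrite /phi; case: pickP => [t /forallP tp|_]; last by rewrite lexx ler01.
rewrite piece_sum sumr_ge0 /= => [|a _]; last by rewrite mulr_ge0.
rewrite -[leRHS](sum_bary (corner t) p (area2_corner t)); apply: ler_sum => a _.
by case: (tri t a == j); rewrite ?mul1r ?mul0r ?tp.
Qed.

(* A supporting line of the domain meets a triangle in the convex hull of the
   vertices lying on that line. *)
Lemma phi_eq0_left x0 j p : (forall q, D q -> x0 <= q.1) -> D p -> p.1 = x0 ->
  (vtx T j).1 != x0 -> phi T j p = 0.
Proof.
move=> Dx /(tri_cover T)[t tp] px jx; rewrite (phi_piece t) //.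
rewrite /piece big1 // => a /eqP aj.
have tp' := forallP tp.
(* The function [q.1 - x0] is nonnegative at the corners and zero at [p], so each term of its
   barycentric expansion vanishes; at a corner off the line the vanishing factor is the
   coordinate. *)
have := affine_bary (fun q => q.1 - x0) (corner t) (- x0) 1 0 p (area2_corner t).
rewrite px subrr => /(_ _)/esym/eqP.
rewrite psumr_eq0 => [|b _]; last first.
  rewrite mulr_ge0 // subr_ge0; apply: Dx; exact: vtx_dom.
have H0 (q : R * R) : q.1 - x0 = - x0 + 1 * q.1 + 0 * q.2 by ring.
move=> /(_ H0)/allP/(_ a); rewrite mem_index_enum => /(_ isT)/=.
by rewrite mulf_eq0 subr_eq0 {2}/corner aj (negPf jx) orbF => /eqP.
Qed.

Definition pickt p := [pick t : 'I_(ntri T) | in_tri t p].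

(** The pieces are affine, so the difference quotient is constant for nonzero increments, and [dphi]
    is piecewise constant. *)
Lemma dphiE k j p : dphi T k j p = if pickt p is Some t then pgrad t j k else 0.
Proof.
rewrite /dphi /pickt; case: pickP => // t _.
have -> : piece t j = (fun q => piece t j 0 + pgrad t j 0 * q.1 + pgrad t j 1 * q.2).
  by apply/funext => q; exact: pieceE.
rewrite /derive.
have -> : (fun h : R => h^-1 *: (((fun q : R * R => piece t j 0 + pgrad t j 0 * q.1
     + pgrad t j 1 * q.2) \o shift p) (h *: evec R k)
   - (piece t j 0 + pgrad t j 0 * p.1 + pgrad t j 1 * p.2)))
   = (fun h => h^-1 * (h * pgrad t j k)).
  apply/funext => h; rewrite /= /GRing.scale /=; congr (_ * _).
  case/orP: (orbN (k == 0)) => [/eqP ->|k1] /=; first by ring.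
  have -> : k = 1 by case: k k1 => [[|[|]]] //= i _; apply: val_inj.
  by rewrite /=; ring.
apply/cvg_lim => //.
apply: (@cvg_trans _ (pgrad t j k @[h --> (0 : R)^'])); last exact: cvg_cst.
apply: near_eq_cvg; near=> h.
have h0 : h != 0 by near: h; exact: nbhs_dnbhs_neq.
by rewrite mulKf.
Unshelve. all: by end_near. Qed.

Definition dphi_bound k j : R := \sum_t `|pgrad t j k|.

Lemma dphi_le k j p : `|dphi T k j p| <= dphi_bound k j.
Proof.
rewrite dphiE /dphi_bound; case: (pickt p) => [t|].
  by rewrite (bigD1 t) //= lerDl sumr_ge0.
by rewrite normr0 sumr_ge0.
Qed.

End Nodal.

(** * Integration along grid-parallel lines *)

Section FTCOffFinite.
Context {R : realType}.
Local Notation mu := (@lebesgue_measure R).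

Lemma cst_off_finite (s : seq R) (f : R -> R) (a b : R) : a <= b ->
  {within `[a, b], continuous f} ->
  (forall x, a < x < b -> x \notin s -> is_derive x 1 f 0) -> f a = f b.
Proof.
elim: s a b => [|c s IH] a b ab cf df.
  have dab x : x \in `]a, b[ -> is_derive x 1 f ((fun=> 0) x).
    by rewrite in_itv /= => /df; exact.
  have [c _ /eqP] := MVT_segment ab dab cf.
  by rewrite mul0r subr_eq0 => /eqP.
have [/andP[ac cb]|nc] := boolP (a < c < b); last first.
  apply: IH => // x xab xs; apply: df => //; rewrite inE negb_or xs andbT.
  by apply: contraNneq nc => <-.
transitivity (f c); apply: IH.
- exact: ltW.
- apply: continuous_subspaceW cf => x /=; rewrite !in_itv /= => /andP[-> xc].
  exact: le_trans xc (ltW cb).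
- move=> x /andP[ax xc] xs; apply: df; first by rewrite ax (lt_trans xc).
  by rewrite inE negb_or xs lt_eqF.
- exact: ltW.
- apply: continuous_subspaceW cf => x /=; rewrite !in_itv /= => /andP[cx ->].
  by rewrite (le_trans (ltW ac)).
- move=> x /andP[cx xb] xs; apply: df; first by rewrite xb (lt_trans ac).
  by rewrite inE negb_or xs gt_eqF.
Qed.

(** [F] minus the indefinite integral of [f] is continuous with zero derivative off [s], hence has
    equal values at the two ends. *)
Lemma FTC_off_finite (s : seq R) (F f : R -> R) (a b : R) : a < b ->
  {within `[a, b], continuous F} ->
  mu.-integrable `[a, b] (EFin \o f) ->
  (forall x, a < x < b -> x \notin s ->
     is_derive x 1 F (f x) /\ {for x, continuous f}) ->
  \int[mu]_(x in `[a, b]) f x = F b - F a.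
Proof.
move=> ab cF intf dF.
pose I x := \int[mu]_(t in `[a, x]) f t.
have cI := parameterized_integral_continuous (ltW ab) intf.
have : (F - I) a = (F - I) b.
  apply: (cst_off_finite s) (ltW ab) _ _.
    exact: within_continuousB cF cI.
  move=> x /andP[ax xb] xs; have [|dFx cfx] := dF x _ xs; first by rewrite ax.
  have [dI dIE] := continuous_FTC1_closed xb intf ax cfx.
  have DI : is_derive x 1 I (f x).
    by rewrite -dIE derive1E; apply/derivableP.
  by apply: is_derive_eq; rewrite subrr.
rewrite /I /= !fctE /I set_itv1 Rintegral_set1 subr0 => ->; ring.
Qed.

End FTCOffFinite.

(** * Measurability and continuity of the nodal functions *)

Section NodalRegularity.
Context {R : realType} {N : nat} {D : set (R * R)} (T : triangulation N D).
Implicit Types (p : R * R) (i j : 'I_N) (k : 'I_2).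

Lemma measurable_affine (c0 c1 c2 : R) :
  measurable_fun setT (fun p : R * R => c0 + c1 * p.1 + c2 * p.2).
Proof.
apply: measurable_funD; first apply: measurable_funD.
- exact: measurable_cst.
- by apply: measurable_funM; [exact: measurable_cst|exact: measurable_fst].
- by apply: measurable_funM; [exact: measurable_cst|exact: measurable_snd].
Qed.

Lemma measurable_bary X a : measurable_fun setT (bary X a : R * R -> R).
Proof.
rewrite (_ : bary X a = fun p => cross 0 (X (a + 1)) (X (a + 2)) / area2 X
    + bary_grad X a 0 * p.1 + bary_grad X a 1 * p.2).
  exact: measurable_affine.
by apply/funext => p; exact: baryE.
Qed.

Lemma measurable_in_tri (t : 'I_(ntri T)) : measurable_fun setT (fun p => in_tri t p).
Proof.
have mb a : measurable_fun setT (fun p : R * R => 0 <= bary (corner t) a p).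
  by apply: measurable_fun_ler; [exact: measurable_cst|exact: measurable_bary].
rewrite (_ : (fun p => _) = fun p => [&& 0 <= bary (corner t) 0 p,
    0 <= bary (corner t) 1 p & 0 <= bary (corner t) 2 p]).
  by apply: measurable_and => //; exact: measurable_and.
apply/funext => p; apply/forallP/and3P => [tp|[p0 p1 p2]]; first by split.
by elim/ord3P.
Qed.

(** Picking the first suitable triangle is a nested conditional with measurable tests, handled by
    induction on the enumeration of the triangles. *)
Lemma measurable_pickt (g : 'I_(ntri T) -> R * R -> R) :
  (forall t, measurable_fun setT (g t)) ->
  measurable_fun setT (fun p => if pickt T p is Some t then g t p else 0).
Proof.
move=> mg; rewrite /pickt /pick /enum_mem.
elim: (Finite.enum _) => [|t s IH] /=; first exact: measurable_cst.
rewrite (_ : (fun p => _) = fun p => if in_tri t p then g t p else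
    if ohead [seq x <- s | in_tri x p] is Some t then g t p else 0).
  exact: (measurable_fun_ifT (measurable_in_tri t) (mg t) IH).
by apply/funext => p; rewrite /= -topredE /=; case: ifP.
Qed.

Lemma measurable_phi j : measurable_fun setT (phi T j).
Proof.
apply: measurable_pickt => t.
rewrite (_ : piece t j = fun p => piece t j 0 + pgrad T t j 0 * p.1 + pgrad T t j 1 * p.2).
  exact: measurable_affine.
by apply/funext => p; exact: pieceE.
Qed.

Lemma measurable_dphi k j : measurable_fun setT (dphi T k j).
Proof.
rewrite (_ : dphi T k j = fun p => if pickt T p is Some t then pgrad T t j k else 0).
  by apply: measurable_pickt => t; exact: measurable_cst.
by apply/funext => p; exact: dphiE.
Qed.

Lemma affine_continuous (c0 c1 c2 : R) :
  continuous (fun p : R * R => c0 + c1 * p.1 + c2 * p.2).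
Proof.
move=> p; apply: cvgD; first apply: cvgD; first exact: cvg_cst.
  by apply: cvgM; [exact: cvg_cst|exact: cvg_fst].
by apply: cvgM; [exact: cvg_cst|exact: cvg_snd].
Qed.

Lemma bary_continuous X a : continuous (bary X a : R * R -> R).
Proof.
rewrite (_ : bary X a = fun p => cross 0 (X (a + 1)) (X (a + 2)) / area2 X
    + bary_grad X a 0 * p.1 + bary_grad X a 1 * p.2).
  exact: affine_continuous.
by apply/funext => p; exact: baryE.
Qed.

Lemma piece_continuous (t : 'I_(ntri T)) j : continuous (piece t j).
Proof.
rewrite (_ : piece t j = fun p => piece t j 0 + pgrad T t j 0 * p.1 + pgrad T t j 1 * p.2).
  exact: affine_continuous.
by apply/funext => p; exact: pieceE.
Qed.

(** A triangle through [p] carries a continuous piece with the right value at [p]; a triangle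
    missing [p] also misses a neighbourhood, where one of its coordinates stays negative. There are
    finitely many triangles, so the neighbourhoods can be intersected. *)
Lemma phi_cvg j p : D p -> phi T j q @[q --> within D (nbhs p)] --> phi T j p.
Proof.
move=> Dp; apply/cvgrPdist_lt => e e0.
have near_t (t : 'I_(ntri T)) : \forall q \near p, in_tri t q -> `|phi T j p - piece t j q| < e.
  have [tp|/forallPn[a]] := boolP (in_tri t p).
    rewrite (phi_piece T t j p tp).
    have /cvgrPdist_lt/(_ e e0) := piece_continuous t j p.
    by apply: filterS.
  rewrite -ltNge => ap.
  have : \forall q \near p, bary (corner t) a q < 0.
    exact: (cvgr_lt _ (bary_continuous (corner t) a p) 0 ap).
  by apply: filterS => q q0 /forallP/(_ a); rewrite leNgt q0.
apply: filterS (filter_forall _ near_t) => q tq /(tri_cover T)[t tqt].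
by rewrite (phi_piece T t j q tqt); exact: tq.
Qed.

End NodalRegularity.

(** * Nodal functions restricted to grid-parallel lines *)

Section Lines.
Context {R : realType} {N : nat} {D : set (R * R)} (T : triangulation N D).
Implicit Types (p : R * R) (i j : 'I_N) (k : 'I_2).

Definition line k (c x : R) : R * R := if k == 0 then (x, c) else (c, x).

Lemma line_continuous k c : continuous (line k c).
Proof.
move=> x; rewrite /line; case: (k == 0).
  exact: (@cvg_pair _ _ _ (nbhs x) (nbhs x) (nbhs c) _ _ _ id (fun=> c) cvg_id (cvg_cst c)).
exact: (@cvg_pair _ _ _ (nbhs x) (nbhs c) (nbhs x) _ _ _ (fun=> c) id (cvg_cst c) cvg_id).
Qed.

Lemma measurable_line k c : measurable_fun setT (line k c).
Proof.
rewrite /line; case: (k == 0).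
  by apply: measurable_fun_pair; [exact: measurable_id|exact: measurable_cst].
by apply: measurable_fun_pair; [exact: measurable_cst|exact: measurable_id].
Qed.

Lemma line_swap k (y x : R) : line k y x = line (k + 1) x y.
Proof. by elim/ord2P: k; rewrite ?ord2D. Qed.

Lemma bary_line X a k (c x : R) :
  bary X a (line k c x) = bary X a (line k c 0) + bary_grad X a k * x.
Proof. by rewrite !baryE; elim/ord2P: k; rewrite /line /=; ring. Qed.

Lemma bary_line0 X a k (c : R) :
  bary X a (line k c 0) = bary X a 0 + bary_grad X a (k + 1) * c.
Proof.
by rewrite !baryE; elim/ord2P: k; rewrite ?ord2D /line /=; ring.
Qed.

Lemma piece_line (t : 'I_(ntri T)) j k c x :
  piece t j (line k c x) = piece t j (line k c 0) + pgrad T t j k * x.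
Proof. by rewrite !(pieceE T t j (line _ _ _)); elim/ord2P: k; rewrite /line /=; ring. Qed.

(* Contains the level of every line in direction [k] through an edge parallel to
   it.  The entries with [bary_grad _ _ k != 0], junk values of divisions by 0
   included, are harmless extra levels. *)
Definition edge_levels k : seq R :=
  [seq - bary (corner ta.1) ta.2 0 / bary_grad (corner ta.1) ta.2 (k + 1)
  | ta : 'I_(ntri T) * 'I_3].

(** The zeros along the line of the barycentric coordinates that vary on it, that is, where it can
    cross an edge. A coordinate constant along the line only adds the point 0. *)
Definition edge_crossings k (c : R) : seq R :=
  [seq - bary (corner ta.1) ta.2 (line k c 0) / bary_grad (corner ta.1) ta.2 k
  | ta : 'I_(ntri T) * 'I_3].

(** A coordinate varying along the line vanishes only at a crossing. One that is constant along it
    varies with the level, and vanishes only at an excluded level. *)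
Lemma bary_off_edges k c x (t : 'I_(ntri T)) a :
  c \notin edge_levels k -> x \notin edge_crossings k c ->
  bary (corner t) a (line k c x) != 0.
Proof.
move=> cE xE; apply/negP => /eqP; rewrite bary_line => b0.
have [g0|g0] := eqVneq (bary_grad (corner t) a k) 0; last first.
  move: xE; apply/negP; rewrite negbK; apply/mapP; exists (t, a).
    by rewrite mem_enum.
  by rewrite /= -[bary _ _ _](addrK (bary_grad (corner t) a k * x)) b0; field.
(* Modulo 2, [k + 1] is the other direction, and the gradient cannot vanish in both. *)
have h0 : bary_grad (corner t) a (k + 1) != 0.
  elim/ord2P: k g0 {cE xE b0} => g0; rewrite ?ord2D.
    exact: bary_grad_neq0 (area2_corner T t) g0.
  apply/negP => /eqP g1; have := bary_grad_neq0 _ _ (area2_corner T t) g1.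
  by rewrite g0 eqxx.
move: cE; apply/negP; rewrite negbK; apply/mapP; exists (t, a).
  by rewrite mem_enum.
move: b0; rewrite g0 mul0r addr0 bary_line0 => b0.
by rewrite /= -[bary _ _ _](addrK (bary_grad (corner t) a (k + 1) * c)) b0; field.
Qed.

(** No coordinate vanishes at the point, so by continuity all their signs are locally constant. *)
Lemma near_in_tri k c x : c \notin edge_levels k -> x \notin edge_crossings k c ->
  \forall z \near x, forall t : 'I_(ntri T), in_tri t (line k c z) = in_tri t (line k c x).
Proof.
move=> cE xE.
have nearb (t : 'I_(ntri T)) a : \forall z \near x,
    (0 <= bary (corner t) a (line k c z)) = (0 <= bary (corner t) a (line k c x)).
  have bc : bary (corner t) a (line k c z) @[z --> x] --> bary (corner t) a (line k c x).
    exact: (continuous_comp (@line_continuous k c x) (@bary_continuous _ (corner t) a _)).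
  have := bary_off_edges k c x t a cE xE; rewrite neq_lt => /orP[b0|b0].
    by apply: filterS (cvgr_lt _ bc 0 b0) => z z0; rewrite !leNgt z0 b0.
  by apply: filterS (cvgr_gt _ bc 0 b0) => z z0; rewrite !ltW.
apply: filterS (filter_forall _ (fun t => filter_forall _ (nearb t))) => z zb t.
by apply: eq_forallb => a; exact: zb.
Qed.

(** Membership in each triangle is locally constant, so the same triangle is picked nearby: there
    [phi] is a single affine piece and [dphi] is constant. *)
Lemma is_derive_phi_line k c x j : D (line k c x) ->
  c \notin edge_levels k -> x \notin edge_crossings k c ->
  is_derive x 1 (fun z => phi T j (line k c z)) (dphi T k j (line k c x))
  /\ \forall z \near x, dphi T k j (line k c z) = dphi T k j (line k c x).
Proof.
move=> Dx cE xE; have nt := near_in_tri k c x cE xE; split; last first.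
  by apply: filterS nt => z zx; rewrite !dphiE /pickt (eq_pick zx).
rewrite dphiE /pickt; case: pickP => [t tx|nx]; last first.
  by have [t] := (tri_cover T _).1 Dx; rewrite nx.
apply: (@near_eq_is_derive _ _ _ (fun z => piece t j (line k c z))).
  by apply: filterS nt => z zx; rewrite (phi_piece T t j _) // zx.
rewrite (_ : (fun z => _) = (fun z => piece t j (line k c 0) + pgrad T t j k * z)); last first.
  by apply/funext => z; exact: piece_line.
apply: (is_derive_eq (is_deriveD (is_derive_cst (piece t j (line k c 0)) x 1)
  (is_deriveZ (pgrad T t j k) (is_derive_id x 1)))).
by rewrite add0r /GRing.scale /= mulr1.
Qed.

Lemma phi_line_continuous k c j (a b : R) : (forall x, a <= x <= b -> D (line k c x)) ->
  {within `[a, b], continuous (fun z => phi T j (line k c z))}.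
Proof.
move=> Dl; apply/subspace_continuousP => x /=; rewrite in_itv /= => xab.
move=> A /(phi_cvg T j _ (Dl x xab)) AD.
apply: (@filterS _ (nbhs x) _ _ _ _ (@line_continuous k c x _ AD)) => z /= zA.
rewrite in_itv /= => zab.
exact: zA (Dl z zab).
Qed.

End Lines.

(** * Area integrals as iterated integrals over lines *)

Section Fubini.
Context {R : realType}.
(* [R] and [mR] have the same measurable sets, but [lebesgue_measure] is typed
   over [mR], which matters for unification on product spaces. *)
Local Notation mR := (measurableTypeR R).
Local Notation mu := (@lebesgue_measure R).

Lemma bounded_integrable d (X : measurableType d) (m : {measure set X -> \bar R})
    (A : set X) (f : X -> R) (M : R) : measurable A -> (m A < +oo)%E ->
  measurable_fun setT f -> (forall x, `|f x| <= M) ->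
  m.-integrable A (EFin \o f).
Proof.
move=> mA mAoo mf fM; apply: measurable_bounded_integrable => //.
  exact: measurable_funS mf.
by exists M; split; [exact: num_real|move=> y My x _; exact: le_trans (fM x) (ltW My)].
Qed.

Lemma Rintegral_fin d (X : measurableType d) (m : {measure set X -> \bar R})
    (A : set X) (f : X -> R) : measurable A -> m.-integrable A (EFin \o f) ->
  (\int[m]_(x in A) (f x)%:E)%E = (\int[m]_(x in A) f x)%:E.
Proof. by move=> mA fi; rewrite /Rintegral fineK //; exact: integrable_fin_num. Qed.

(** Fubini for the extension of [g] by zero, in the order selected by [k]. The finite set [s] of
    levels is negligible, so the inner integral has to be identified only off [s]; levels outside
    [J] miss [D]. *)
Lemma int2_line k (I J : set R) (D : set (R * R)) (g : R * R -> R) (h : R -> R)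
    (s : seq R) : measurable (I : set mR) -> measurable (J : set mR) ->
  measurable (D : set (mR * mR)) ->
  (forall y x, D (line k y x) <-> J y /\ I x) ->
  integrable2 D g -> measurable_fun setT (h : mR -> R) ->
  (forall y, J y -> y \notin s -> mu.-integrable I (EFin \o (g \o line k y)) /\
    \int[mu]_(x in I) g (line k y x) = h y) ->
  int2 D g = \int[mu]_(y in J) h y.
Proof.
move=> mI mJ mD Dl gi mh gh.
pose f : mR * mR -> \bar R := (EFin \o g) \_ D.
have fi : (mu \x mu)%E.-integrable setT f.
  exact: (@integrable_mkcond _ _ _ (mu \x mu)%E D (EFin \o g) mD).1 gi.
pose K (y : mR) := (\int[mu]_x f (line k y x))%E.
have [mK intK] : measurable_fun setT K /\ (\int[mu]_y K y = \int[mu \x mu]_p f p)%E.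
  rewrite /K /line; case: (k == 0).
    split; first exact: (measurable_fubini_G fi).
    exact: (integral21_prod_meas1 fi).
  split; first exact: (measurable_fubini_F fi).
  exact: (integral12_prod_meas1 fi).
rewrite /int2 /Rintegral; congr fine.
rewrite integral_mkcond -/f -intK [RHS]integral_mkcond.
apply: ae_eq_integral => //.
  apply/(measurable_restrictT _ mJ); apply: measurable_funS (measurableT_comp _ mh) => //.
exists [set` s]; split.
- exact/countable_measurable/finite_set_countable/finite_seq.
- exact/countable_lebesgue_measure0/finite_set_countable/finite_seq.
move=> y /=; apply: contra_notP => ys _.
rewrite patchE; case: ifPn => yJ.
  rewrite inE in yJ.
  have [gl <-] := gh y yJ (introN idP ys).
  rewrite -Rintegral_fin // [RHS]integral_mkcond; apply: eq_integral => x _.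
  rewrite /f !patchE; congr (if _ then _ else _).
  apply/idP/idP => /set_mem H; apply/mem_set; first by case: ((Dl y x).1 H).
  exact: (Dl y x).2.
apply: integral0_eq => x _; rewrite /f patchE ifN //.
by apply: contra yJ => /set_mem H; apply/mem_set; case: ((Dl y x).1 H).
Qed.

End Fubini.

(** * The finite element matrices *)

Section Gram.
Context {R : realType}.

(** The transpose of a row of the left kernel annihilates the quadratic form, so that row is
    zero. *)
Lemma unitmx_of_definite q (M : 'M[R]_q) :
  (forall v, dot v (M *m v) = 0 -> v = 0) -> M \in unitmx.
Proof.
move=> Mdef; rewrite -row_free_unit -kermx_eq0; apply/eqP/row_matrixP => i.
rewrite row0; apply: trmx_inj; rewrite trmx0; apply: Mdef.
by rewrite /dot trmxK mulmxA -row_mul mulmx_ker row0 mul0mx mxE.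
Qed.

Context d (X : measurableType d) (m : {measure set X -> \bar R}).

Lemma Rintegral_sum (I : Type) (s : seq I) (A : set X) (f : I -> X -> R) :
  measurable A -> (forall i, m.-integrable A (EFin \o f i)) ->
  m.-integrable A (EFin \o (fun x => \sum_(i <- s) f i x)) /\
  \int[m]_(x in A) (\sum_(i <- s) f i x) = \sum_(i <- s) \int[m]_(x in A) f i x.
Proof.
move=> mA fi; elim: s => [|i s [IH1 IH2]].
  under [EFin \o _]eq_fun do rewrite /= big_nil.
  under eq_Rintegral do rewrite big_nil.
  by rewrite big_nil Rintegral_cst // mul0r; split=> //; exact: integrable0.
rewrite (_ : (fun x => _) = (fun x => f i x + \sum_(i <- s) f i x)); last first.
  by apply/funext => x; rewrite big_cons.
split; first exact: (integrableD mA (fi i) IH1).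
by rewrite RintegralD // IH2 big_cons.
Qed.

(** Turns the form of a matrix of integrals into the integral of a pointwise form, from which
    definiteness and nonnegativity can be read off. *)
Lemma gram_dot q (A : set X) (f : 'I_q -> 'I_q -> X -> R) (v : 'cV[R]_q) :
  measurable A -> (forall i j, m.-integrable A (EFin \o f i j)) ->
  m.-integrable A (EFin \o (fun x => \sum_i \sum_j v i 0 * v j 0 * f i j x)) /\
  dot v ((\matrix_(i, j) \int[m]_(x in A) f i j x) *m v) =
  \int[m]_(x in A) \sum_i \sum_j v i 0 * v j 0 * f i j x.
Proof.
move=> mA fi.
have fZ i j : m.-integrable A (EFin \o (fun x => v i 0 * v j 0 * f i j x)).
  rewrite (_ : _ \o _ = (fun x => (v i 0 * v j 0)%:E * (EFin \o f i j) x)%E) //.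
  exact: integrableZl.
have fS i := Rintegral_sum _ (index_enum 'I_q) A _ mA (fZ i).
have [SS1 SS2] := Rintegral_sum _ (index_enum 'I_q) A _ mA (fun i => (fS i).1).
split; first exact: SS1.
rewrite SS2 dotE.
apply: eq_bigr => i _; rewrite (fS i).2 mxE mulr_sumr; apply: eq_bigr => j _.
by rewrite mxE RintegralZl //; ring.
Qed.

(** Markov's inequality: [e] times the measure of [E] is at most the integral over [A]. *)
Lemma ge0_Rintegral0 (A E : set X) (f : X -> R) (e : R) :
  measurable A -> measurable E -> E `<=` A -> m.-integrable A (EFin \o f) ->
  (forall x, 0 <= f x) -> 0 < e -> (forall x, E x -> e <= f x) ->
  \int[m]_(x in A) f x = 0 -> m E = 0.
Proof.
move=> mA mE EA fi f0 e0 ef If0.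
have [mf _] := integrableP _ _ _ fi.
have I0 : (\int[m]_(x in A) (f x)%:E = 0)%E by rewrite Rintegral_fin // If0.
have le1 : (\int[m]_(x in E) (cst e%:E) x <= \int[m]_(x in A) (f x)%:E)%E.
  apply: (@le_trans _ _ (\int[m]_(x in E) (f x)%:E)%E).
    apply: ge0_le_integral => //.
    - by move=> x _; rewrite lee_fin ltW.
    - exact: measurable_funS mf.
  by apply: ge0_subset_integral => // x _; rewrite lee_fin.
move: le1; rewrite I0 integral_cst // pmule_rle0 ?lte_fin // => mE0.
by apply/eqP; rewrite eq_le mE0 measure_ge0.
Qed.

End Gram.

Lemma itv_sub_ball {R : realType} (a b p e : R) : a < b -> a <= p <= b -> 0 < e ->
  exists c d, [/\ c < d, `[c, d] `<=` `[a, b] & `[c, d] `<=` ball p e].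
Proof.
move=> ab /andP[ap pb] e0.
(* The interval of radius [e / 2] around [p], clipped to [[a, b]]: it keeps positive length even if
   [p] is an end point, and half the radius keeps it inside the open ball. *)
exists (Num.max a (p - e / 2)), (Num.min b (p + e / 2)).
have e2 : 0 < e / 2 by rewrite divr_gt0.
split.
- rewrite gt_max !lt_min ab /=; apply/and3P; split; lra.
- move=> x /=; rewrite !in_itv /= ge_max le_min => /andP[/andP[-> _]/andP[-> _]] //.
- move=> x /=; rewrite in_itv /= ge_max le_min => /andP[/andP[_ px]/andP[_ xp]].
  by rewrite /ball /= ltr_norml; apply/andP; split; lra.
Qed.

(** * Invertible mass matrices, interface nodes, and products of basis functions on lines *)

Section FemFacts.
Context {R : realType} {G : blocks R} {N r : nat} (B : fe_block G N r).

Local Notation mR := (measurableTypeR R).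
Local Notation mu := (@lebesgue_measure R).
Local Notation D := (OmegaR G).
Local Notation T := (mesh B).
Local Notation phi := (phi T).
Local Notation dphi := (dphi T).

Lemma OmegaR_rect : D = `[xI G, xE G]%classic `*` `[yS G, yN G]%classic.
Proof.
apply/seteqP; split => p; rewrite /OmegaR /= !in_itv /=.
  by move=> /andP[].
by move=> [-> ->].
Qed.

Lemma measurable_OmegaR : measurable (D : set (mR * mR)).
Proof. by rewrite OmegaR_rect; apply: measurableX; exact: measurable_itv. Qed.

Lemma itv_measure (x y : R) : x < y -> mu `[x, y] = (y - x)%:E.
Proof. by move=> xy; rewrite lebesgue_measure_itv /= lte_fin xy -EFinB. Qed.

Lemma rect_measure (a b c d : R) : a < b -> c < d ->
  (mu \x mu)%E (`[a, b]%classic `*` `[c, d]%classic) = ((b - a) * (d - c))%:E.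
Proof.
move=> /itv_measure abE /itv_measure cdE; rewrite EFinM -abE -cdE.
by apply: product_measure1E; exact: measurable_itv.
Qed.

Lemma OmegaR_fin : ((mu \x mu)%E D < +oo)%E.
Proof. by rewrite OmegaR_rect rect_measure ?lt_xIE ?lt_ySN // ltry. Qed.

Lemma OmegaR_bounded_int (g : R * R -> R) M : measurable_fun setT g ->
  (forall p, `|g p| <= M) -> integrable2 D g.
Proof.
by move=> mg gM; exact: (bounded_integrable _ _ _ _ _ M measurable_OmegaR OmegaR_fin mg gM).
Qed.

Lemma normr_phi j p : `|phi j p| <= 1.
Proof. by have /andP[p0 p1] := phi_itv T j p; rewrite ger0_norm. Qed.

Lemma phi_phi_int i j : integrable2 D (fun p => phi j p * phi i p).
Proof.
apply: (OmegaR_bounded_int _ 1).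
  by apply: measurable_funM; exact: measurable_phi.
by move=> p; rewrite normrM mulr_ile1 ?normr_phi.
Qed.

Lemma dphi_phi_int k i j : integrable2 D (fun p => dphi k j p * phi i p).
Proof.
apply: (OmegaR_bounded_int _ (dphi_bound T k j)).
  by apply: measurable_funM; [exact: measurable_dphi|exact: measurable_phi].
move=> p; rewrite normrM -[leRHS]mulr1.
by rewrite ler_pM ?normr_phi ?dphi_le.
Qed.

Definition nodal (v : 'cV[R]_N) (p : R * R) : R := \sum_i v i 0 * phi i p.

Lemma nodal_vertex (v : 'cV[R]_N) i : nodal v (vtx T i) = v i 0.
Proof.
rewrite /nodal (bigD1 i) //= phi_vertex eqxx mulr1 big1 ?addr0 // => j ji.
by rewrite phi_vertex eq_sym (negPf ji) mulr0.
Qed.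

Lemma nodal_sqr (v : 'cV[R]_N) p :
  \sum_i \sum_j v i 0 * v j 0 * (phi j p * phi i p) = nodal v p ^+ 2.
Proof.
rewrite expr2 {1}/nodal mulr_suml; apply: eq_bigr => i _.
by rewrite /nodal mulr_sumr; apply: eq_bigr => j _; ring.
Qed.

(** By continuity within the domain, the function keeps at least half the modulus of its nodal value
    near the vertex. *)
Lemma nodal_lower (v : 'cV[R]_N) i : v i 0 != 0 -> exists2 e, 0 < e &
  forall q, D q -> ball (vtx T i) e q -> (v i 0 / 2) ^+ 2 <= nodal v q ^+ 2.
Proof.
move=> vi.
have cv : nodal v q @[q --> within D (nbhs (vtx T i))] --> nodal v (vtx T i).
  rewrite /nodal; apply: cvg_big => [|j _]; first exact: add_continuous.
  apply: cvgM; first exact: cvg_cst.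
  exact: phi_cvg (vtx_dom T i).
have h0 : 0 < `|v i 0| / 2 by rewrite divr_gt0 ?normr_gt0.
have /cvgrPdist_lt/(_ _ h0) := cv.
rewrite /within /= => /nbhs_ballP[e /= e0 be]; exists e => // q Dq qb.
have := be q qb Dq; rewrite nodal_vertex => vq.
have {}vq : `|v i 0| / 2 <= `|nodal v q|.
  have := ler_dist_dist (v i 0) (nodal v q).
  move: vq; have := ler_norm (`|v i 0| - `|nodal v q|); lra.
rewrite -(real_normK (num_real (_ / 2))) -(real_normK (num_real (nodal v q))).
rewrite ler_sqr ?nnegrE ?normr_ge0 //.
by rewrite normrM (ger0_norm (_ : 0 <= 2^-1)) ?invr_ge0.
Qed.

(** A nonzero nodal value would keep the squared function above a positive constant on a small
    rectangle inside the domain, and that rectangle would then have measure zero. *)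
Lemma MR_definite v : dot v (MR B *m v) = 0 -> v = 0.
Proof.
have [] := gram_dot _ _ (mu \x mu)%E _ D (fun i j p => phi j p * phi i p) v
  measurable_OmegaR (fun i j => phi_phi_int i j).
rewrite (_ : (fun p => _) = (fun p => nodal v p ^+ 2)); last first.
  by apply/funext => p; exact: nodal_sqr.
move=> sqi intE; rewrite [X in X = _ -> _]intE.
move=> I0; apply/matrixP => i j; rewrite ord1 mxE; apply/eqP.
apply/negP => /negP vi; have [e e0 lower] := nodal_lower v i vi.
have := vtx_dom T i; rewrite /OmegaR /= => /andP[px py].
have [a [b [ab abI abe]]] := itv_sub_ball _ _ _ _ (lt_xIE G) px e0.
have [c [d [cd cdI cde]]] := itv_sub_ball _ _ _ _ (lt_ySN G) py e0.
have sub : `[a, b]%classic `*` `[c, d]%classic `<=` D.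
  by rewrite OmegaR_rect => p [/abI ? /cdI].
have mE : measurable (`[a, b]%classic `*` `[c, d]%classic : set (mR * mR)).
  by apply: measurableX; exact: measurable_itv.
have vi0 : 0 < (v i 0 / 2) ^+ 2.
  by rewrite exprn_even_gt0 // mulf_neq0 ?invr_neq0.
have low p : (`[a, b]%classic `*` `[c, d]%classic) p -> (v i 0 / 2) ^+ 2 <= nodal v p ^+ 2.
  by move=> pE; apply: lower; [exact: sub|split; [exact: abe pE.1|exact: cde pE.2]].
have E0 := ge0_Rintegral0 _ _ (mu \x mu)%E _ _ _ _ measurable_OmegaR mE sub sqi
  (fun p => sqr_ge0 _) vi0 low I0.
have [/eqP] := etrans (esym (rect_measure _ _ _ _ ab cd)) E0.
by rewrite mulf_eq0 !subr_eq0 !gt_eqF.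
Qed.

Lemma MR_unit : MR B \in unitmx.
Proof. exact: unitmx_of_definite MR_definite. Qed.

Lemma west_inj : injective (west B).
Proof.
move=> a b ab; apply: val_inj; case: (ltngtP a b) => // /(@west_mono _ _ _ _ B);
  by rewrite ab ltxx.
Qed.

Lemma mul_LWT q (M : 'M[R]_(r, q)) a j : ((LW B)^T *m M) (west B a) j = M a j.
Proof.
rewrite mxE (bigD1 a) //= !mxE eqxx mul1r big1 ?addr0 // => b ba.
by rewrite !mxE (inj_eq west_inj) (negPf ba) mul0r.
Qed.

Lemma mul_LW q (M : 'M[R]_(N, q)) a j : (LW B *m M) a j = M (west B a) j.
Proof.
rewrite mxE (bigD1 (west B a)) //= !mxE eqxx mul1r big1 ?addr0 // => i ia.
by rewrite !mxE eq_sym (negPf ia) mul0r.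
Qed.

(** The product of [(LW B)^T] and [LW B] projects onto the West nodes, so it fixes a matrix whose
    other rows vanish. *)
Lemma west_lift q (M : 'M[R]_(N, q)) :
  (forall i j, (forall a, west B a != i) -> M i j = 0) ->
  (LW B)^T *m (LW B *m M) = M.
Proof.
move=> M0; apply/matrixP => i j.
have [[a <-]|ni] := pselect (exists a, west B a = i); first by rewrite mul_LWT mul_LW.
have ni' a : west B a != i by apply/eqP => ai; apply: ni; exists a.
rewrite M0 // mxE big1 // => a _.
by rewrite !mxE (negPf (ni' a)) mul0r.
Qed.

Lemma OmegaR_west y : y \in `[yS G, yN G] -> D (xI G, y).
Proof. by rewrite in_itv /OmegaR /= lexx => ->; rewrite ltW // lt_xIE. Qed.

(** The West side lies on a supporting line of the domain, so [phi_eq0_left] applies to every vertex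
    off it. *)
Lemma phi_west0 i y : (forall a, west B a != i) -> y \in `[yS G, yN G] ->
  phi i (xI G, y) = 0.
Proof.
move=> ni yI; apply: (phi_eq0_left T (xI G)) => //.
- by move=> q /andP[/andP[]].
- exact: OmegaR_west.
- by apply/eqP => /(west_mem B)[a ai]; move: (ni a); rewrite ai eqxx.
Qed.

Lemma LW_RM : (LW B)^T *m (LW B *m RM B West) = RM B West.
Proof.
apply: west_lift => i j ni; rewrite mxE /side_int.
rewrite (_ : 0 = \int[mu]_(y in `[yS G, yN G]) (cst 0 y)); last first.
  by rewrite Rintegral_cst ?mul0r.
by apply: eq_Rintegral => y; rewrite inE /= => yI; rewrite (phi_west0 i) // mulr0.
Qed.

Lemma LW_RC (P : problem G) : (LW B)^T *m (LW B *m RC P B West) = RC P B West.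
Proof.
apply: west_lift => i j ni; rewrite mxE /side_int.
rewrite (_ : 0 = \int[mu]_(y in `[yS G, yN G]) (cst 0 y)); last first.
  by rewrite Rintegral_cst ?mul0r.
by apply: eq_Rintegral => y; rewrite inE /= => yI; rewrite (phi_west0 i) // mulr0.
Qed.

Lemma itv_fin (a b : R) : (mu `[a, b] < +oo)%E.
Proof. by rewrite lebesgue_measure_itv /=; case: ifP; rewrite -?EFinB ltry. Qed.

Lemma phi_phi_line_int k c i j (a b : R) :
  mu.-integrable `[a, b] (EFin \o (fun x => phi j (line k c x) * phi i (line k c x))).
Proof.
apply: (bounded_integrable _ _ _ _ _ 1) => //.
- exact: itv_fin.
- by apply: measurable_funM; apply: measurableT_comp (measurable_phi T _) (measurable_line k c).
- by move=> x; rewrite normrM mulr_ile1 ?normr_phi.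
Qed.

(** The argument of [MR_definite] on the West side, with a segment in place of the rectangle; it
    controls the nodal values on that side. *)
Lemma RM_west_vertex v a : dot v (RM B West *m v) = 0 -> v (west B a) 0 = 0.
Proof.
have [] := gram_dot _ _ mu _ `[yS G, yN G]%classic
  (fun i j y => phi j (xI G, y) * phi i (xI G, y)) v
  (measurable_itv _) (fun i j => phi_phi_line_int 1 (xI G) i j (yS G) (yN G)).
rewrite (_ : (fun y => _) = (fun y => nodal v (xI G, y) ^+ 2)); last first.
  by apply/funext => y; exact: nodal_sqr.
move=> sqi intE; rewrite [X in X = _ -> _]intE => I0.
apply/eqP; apply/negP => /negP vi; have [e e0 lower] := nodal_lower v _ vi.
have vx : (vtx T (west B a)).1 = xI G by apply/(west_mem B); exists a.
have := vtx_dom T (west B a); rewrite /OmegaR /= => /andP[px py].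
have [c [d [cd cdI cde]]] := itv_sub_ball _ _ _ _ (lt_ySN G) py e0.
have vi0 : 0 < (v (west B a) 0 / 2) ^+ 2.
  by rewrite exprn_even_gt0 // mulf_neq0 ?invr_neq0.
have low y : `[c, d]%classic y -> (v (west B a) 0 / 2) ^+ 2 <= nodal v (xI G, y) ^+ 2.
  move=> yE; apply: lower; first exact/OmegaR_west/cdI.
  by split; [rewrite vx; exact: ballxx|exact: cde].
have E0 := ge0_Rintegral0 _ _ mu _ _ _ _ (measurable_itv _) (measurable_itv _) cdI sqi
  (fun p => sqr_ge0 _) vi0 low I0.
have [/eqP] := etrans (esym (itv_measure _ _ cd)) E0.
by rewrite subr_eq0 gt_eqF.
Qed.

(** The form of [MI] at [w] is the form of the West boundary mass matrix at the extension of [w] by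
    zero. *)
Lemma MI_unit : MI B \in unitmx.
Proof.
apply: unitmx_of_definite => w.
have -> : dot w (MI B *m w) = dot ((LW B)^T *m w) (RM B West *m ((LW B)^T *m w)).
  by rewrite /MI dotMl trmxK !mulmxA.
move=> w0; apply/matrixP => a j; rewrite ord1 mxE.
by rewrite -(RM_west_vertex _ a w0) mul_LWT.
Qed.

(** The integrand is the derivative of the product of the two basis functions, and is continuous off
    [edge_crossings], so [FTC_off_finite] applies. *)
Lemma phi_phi_line_FTC k c i j (a b : R) : a < b ->
  (forall x, a <= x <= b -> D (line k c x)) -> c \notin edge_levels T k ->
  mu.-integrable `[a, b] (EFin \o ((fun p => dphi k j p * phi i p + dphi k i p * phi j p)
     \o line k c)) /\
  \int[mu]_(x in `[a, b])
    (dphi k j (line k c x) * phi i (line k c x) + dphi k i (line k c x) * phi j (line k c x))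
  = phi j (line k c b) * phi i (line k c b) - phi j (line k c a) * phi i (line k c a).
Proof.
move=> ab Dl cE.
have fi : mu.-integrable `[a, b] (EFin \o ((fun p => dphi k j p * phi i p + dphi k i p * phi j p)
     \o line k c)).
  apply: (bounded_integrable _ _ _ _ _ (dphi_bound T k j + dphi_bound T k i)) => //.
  - exact: itv_fin.
  - apply: measurableT_comp (measurable_line k c).
    by apply: measurable_funD; apply: measurable_funM;
      (exact: measurable_dphi || exact: measurable_phi).
  - move=> x /=; apply: le_trans (ler_normD _ _) _; rewrite !normrM.
    by apply: lerD; rewrite -[leRHS]mulr1 ler_pM ?normr_phi ?dphi_le.
split=> //.
have cphi j' := phi_line_continuous T k c j' a b Dl.
apply: (FTC_off_finite (edge_crossings T k c)
   (fun x => phi j (line k c x) * phi i (line k c x)) _ _ _ ab) => //.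
  move=> x; apply: cvgM; [exact: cphi|exact: cphi].
move=> x /andP[ax xb] xE.
have Dx : D (line k c x) by apply: Dl; rewrite !ltW.
have [dj nj] := is_derive_phi_line T k c x j Dx cE xE.
have [di ni] := is_derive_phi_line T k c x i Dx cE xE.
split.
  have D1 := is_deriveM dj di.
  apply: (is_derive_eq D1).
  by rewrite /GRing.scale /=; ring.
have cont j' : is_derive x 1 (fun z => phi j' (line k c z)) (dphi k j' (line k c x)) ->
    phi j' (line k c z) @[z --> x] --> phi j' (line k c x).
  move=> d.
  apply: (@differentiable_continuous _ _ _ x (fun z => phi j' (line k c z))).
  by apply/derivable1_diffP; exact: ex_derive.
have dcont j' : (\forall z \near x, dphi k j' (line k c z) = dphi k j' (line k c x)) ->
    dphi k j' (line k c z) @[z --> x] --> dphi k j' (line k c x).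
  move=> nd.
  have nd' : {near x, (fun=> dphi k j' (line k c x)) =1 (fun z => dphi k j' (line k c z))}.
    by apply: filterS nd => z ->.
  by apply: cvg_trans (near_eq_cvg nd') _; exact: cvg_cst.
by apply: cvgD; apply: cvgM; (exact: cont || exact: dcont).
Qed.

End FemFacts.

(** * Integration by parts and the sign of the stiffness matrix *)

Section FemOperators.
Context {R : realType} {G : blocks R} {N r : nat} (B : fe_block G N r).

Local Notation mR := (measurableTypeR R).
Local Notation mu := (@lebesgue_measure R).
Local Notation D := (OmegaR G).
Local Notation T := (mesh B).
Local Notation phi := (phi T).
Local Notation dphi := (dphi T).

(** The symmetrized entry integrates the [k]-derivative of a product of basis functions: each line
    contributes a difference of end values, and Fubini sums over the levels. *)
Lemma QR_line k i j (a b c d : R) : a < b ->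
  (forall y x, D (line k y x) <-> `[c, d]%classic y /\ `[a, b]%classic x) ->
  (QR B k + (QR B k)^T) i j =
    \int[mu]_(y in `[c, d]) (phi j (line k y b) * phi i (line k y b))
    - \int[mu]_(y in `[c, d]) (phi j (line k y a) * phi i (line k y a)).
Proof.
move=> ab Dl.
have intD : int2 D (fun p => dphi k j p * phi i p) + int2 D (fun p => dphi k i p * phi j p)
    = int2 D (fun p => dphi k j p * phi i p + dphi k i p * phi j p).
  apply/esym; apply: RintegralD; first exact: measurable_OmegaR.
    exact: dphi_phi_int.
  exact: dphi_phi_int.
have phi_line_int x : mu.-integrable `[c, d]
    (EFin \o (fun y => phi j (line k y x) * phi i (line k y x))).
  (* As the level varies, the end point runs along a line in the other direction. *)
  rewrite (_ : (fun y => _) = (fun y => phi j (line (k + 1) x y) * phi i (line (k + 1) x y))).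
    exact: phi_phi_line_int.
  by apply/funext => y; rewrite !(line_swap k y x).
rewrite !mxE intD -RintegralB //.
apply: (int2_line k `[a, b]%classic _ _ _ _ (edge_levels T k)) => //.
- exact: measurable_OmegaR.
- apply: (@integrableD _ _ _ (mu \x mu)%E D measurable_OmegaR
    (EFin \o (fun p => dphi k j p * phi i p)) (EFin \o (fun p => dphi k i p * phi j p)));
  exact: dphi_phi_int.
- have lm x : measurable_fun setT (fun y : R => line k y x).
    rewrite (_ : (fun y => _) = line (k + 1) x); first exact: measurable_line.
    by apply/funext => y; exact: line_swap.
  by apply: measurable_funB; apply: measurable_funM;
    exact: (measurableT_comp (measurable_phi T _) (lm _)).
move=> y yJ yE; apply: (phi_phi_line_FTC B k y i j a b ab _ yE) => x xab.
by apply/Dl; split=> //=; rewrite in_itv.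
Qed.

Lemma QR_sbp k : QR B k + (QR B k)^T =
  normal R North k *: RM B North + normal R East k *: RM B East
  + normal R South k *: RM B South + normal R West k *: RM B West.
Proof.
apply/matrixP => i j; elim/ord2P: k.
  rewrite (QR_line 0 i j (xI G) (xE G) (yS G) (yN G) (lt_xIE G)).
    by rewrite !mxE /normal /side_int /line /=; ring.
  move=> y x; rewrite /line /OmegaR /= !in_itv /=.
  by split=> [/andP[]|[-> ->]].
rewrite (QR_line 1 i j (yS G) (yN G) (xI G) (xE G) (lt_ySN G)).
  by rewrite !mxE /normal /side_int /line /=; ring.
move=> y x; rewrite /line /OmegaR /= !in_itv /=.
by split=> [/andP[]|[-> ->]].
Qed.

(** The form is the integral of the coefficient times the squared gradient of the finite element
    function. Its entries exist because [epsR] is integrable and the gradients are bounded. *)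
Lemma AR_ge0 (P : problem G) v : 0 <= dot v (AR P B *m v).
Proof.
have fi i j : integrable2 D (fun p => epsR P p * \sum_(k < 2) dphi k j p * dphi k i p).
  have mS : measurable_fun setT (fun p => \sum_(k < 2) dphi k j p * dphi k i p).
    by apply: measurable_sum => k; apply: measurable_funM; exact: measurable_dphi.
  have bS p : `|\sum_(k < 2) dphi k j p * dphi k i p| <=
      \sum_(k < 2) dphi_bound T k j * dphi_bound T k i.
    apply: le_trans (ler_norm_sum _ _ _) _; apply: ler_sum => k _.
    by rewrite normrM ler_pM ?dphi_le.
  pose S p := \sum_(k < 2) dphi k j p * dphi k i p.
  have mSD : measurable_fun D (S : mR * mR -> R) by exact: measurable_funS mS.
  have bSD : [bounded S p | p in D].
    exists (\sum_(k < 2) dphi_bound T k j * dphi_bound T k i); split; first exact: num_real.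
    by move=> y My p _; exact: le_trans (bS p) (ltW My).
  have := @integrableMr _ _ _ (mu \x mu)%E D measurable_OmegaR S _ mSD bSD (epsR_int P).
  rewrite (_ : (_ \* _)%E = EFin \o (fun p => epsR P p * S p)) //.
  by apply/funext => p; rewrite /= -EFinM mulrC.
have [_ intE] := gram_dot _ _ (mu \x mu)%E _ D
  (fun i j p => epsR P p * \sum_(k < 2) dphi k j p * dphi k i p) v measurable_OmegaR fi.
rewrite [leRHS]intE; apply: Rintegral_ge0 => p Dp.
have -> : \sum_i \sum_j v i 0 * v j 0 * (epsR P p * \sum_(k < 2) dphi k j p * dphi k i p)
   = epsR P p * \sum_(k < 2) (\sum_i v i 0 * dphi k i p) ^+ 2.
  apply/esym; under eq_bigr do rewrite expr2 mulr_suml.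
  rewrite exchange_big mulr_sumr; apply: eq_bigr => i _.
  under eq_bigr do rewrite mulr_sumr.
  rewrite exchange_big mulr_sumr; apply: eq_bigr => j _.
  by rewrite !mulr_sumr; apply: eq_bigr => k _; ring.
by rewrite mulr_ge0 ?(ltW (epsR_gt0 P Dp)) // sumr_ge0 // => k _; exact: sqr_ge0.
Qed.

End FemOperators.

(** * Energy estimates *)

Section FEEnergy.
Context {R : realType} {G : blocks R} (P : problem G) {N r : nat}.
Context (B : fe_block G N r).

Lemma MR_tr : (MR B)^T = MR B.
Proof. by apply/matrixP => i j; rewrite !mxE; congr int2; apply/funext => p; rewrite mulrC. Qed.

Lemma RM_tr s : (RM B s)^T = RM B s.
Proof. by apply/matrixP => i j; rewrite !mxE; congr side_int; apply/funext => p; rewrite mulrC. Qed.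

Lemma MI_tr : (MI B)^T = MI B.
Proof. by rewrite /MI !trmx_mul trmxK RM_tr mulmxA. Qed.

(** Basis functions of other nodes vanish on the West side, so rows and, by symmetry, columns can be
    restricted to the interface nodes. *)
Lemma RM_feI v w : dot v (RM B West *m w) = dot (feI B v) (MI B *m feI B w).
Proof.
rewrite /MI /feI -!mulmxA dotMl -{1}(LW_RM B) -{1}[RM B West]RM_tr -{1}(LW_RM B).
by rewrite !trmx_mul trmxK RM_tr !mulmxA.
Qed.

Lemma LW_west : LW B *m (LW B)^T = 1%:M.
Proof.
apply/matrixP => a b; rewrite mul_LW !mxE.
by rewrite (inj_eq (west_inj B)) eq_sym.
Qed.

Lemma RM_LWT v q : dot v (RM B West *m ((LW B)^T *m q)) = dot (feI B v) (MI B *m q).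
Proof. by rewrite RM_feI /feI [LW B *m (_ *m _)]mulmxA LW_west mul1mx. Qed.

(** [MI] cancels the inverse in [DxW], and [LW_RC] restores the full matrix. The sign appears
    because the outward normal on the West side points in the negative x direction. *)
Lemma RC_feI v w : dot v (RC P B West *m w) = - dot (feI B v) (MI B *m (DxW P B *m w)).
Proof.
have -> : DxW P B *m w = - (invmx (MI B) *m (LW B *m (RC P B West *m w))).
  by rewrite /DxW mulNmx -!mulmxA.
rewrite mulmxN mulKVmx ?MI_unit // dotNr opprK.
by rewrite -{1}(LW_RC B P) -!mulmxA dotMr trmxK.
Qed.

(** The mass matrix has to cancel its inverse. In the [assembled] form the inverse stands outermost;
    in the [pointwise] form [dF] stands in front of it, hence the commutation hypothesis. *)
Lemma fe_convection (c : fe_product) (v : 'cV[R]_N) :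
  (c = pointwise -> forall k, MR B *m dF P k v = dF P k v *m MR B) ->
  dot v (MR B *m \sum_(k < 2) (invmx (MR B) *m QR B k *m af P k v
           + talpha P k *: fe_dF_prod P B c k v))
  = \sum_(k < 2) dot v ((QR B k + (QR B k)^T) *m af P k v).
Proof.
move=> comm; rewrite mulmx_sumr dot_sumr; apply: eq_bigr => k _.
have -> : MR B *m (invmx (MR B) *m QR B k *m af P k v + talpha P k *: fe_dF_prod P B c k v)
    = QR B k *m af P k v + talpha P k *: (dF P k v *m (QR B k *m v)).
  rewrite mulmxDr -[MR B *m (talpha _ _ *: _)]scalemxAr -!mulmxA mulKVmx ?MR_unit //.
  case: c comm => [_|/(_ erefl k) comm] /=; first by rewrite mulKVmx ?MR_unit.
  by rewrite [MR B *m _]mulmxA comm -mulmxA mulKVmx ?MR_unit.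
by rewrite dotDr dotZr af_dF mulmxDl dotDr [dot (af _ _ _) _]dotC dotMl.
Qed.

End FEEnergy.

(** * Rate of change of the energy, block by block and coupled *)

Section Rate.
Context {R : realType} {G : blocks R} (P : problem G) {n m N r : nat}.
Context (L : fd_block G n m) (E : fe_block G N r).
Context (IL2R : 'M[R]_(r, m.+2)) (IR2L : 'M[R]_(m.+2, r)).

Local Notation Hx := (sbpH (Sx L)).
Local Notation Hy := (sbpH (Sy L)).

Lemma fdI_af k (u : fdvec R n m) : fdI (af P k u) = af P k (fdI u).
Proof. by rewrite /fdI rowx_af. Qed.

(** The weights one half cancel the convective interface term of the block, and [dL + sL = -1]
    cancels the diffusive one. Besides the outer terms, only those mixing [u] and [v] survive. *)
Lemma fd_rate (u s : fdvec R n m) (ut : fdvec R n m) (v : 'cV[R]_N) dL sL :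
  ut + \sum_(k < 2)
         (invmx (HL L) *m QL L k *m af P k u
          + talpha P k *: (dF P k u *m (invmx (HL L) *m QL L k *m u)))
    = invmx (HL L) *m RL P L *m u + s + SAT_IL P L E IR2L 2^-1 2^-1 dL sL u v ->
  dL + sL = -1 ->
  2 * dot u (HL L *m ut) <=
    fd_outer P L u + 2 * (u^T *m HL L *m s) 0 0
    - dot (fdI u) (Hy *m (IR2L *m feI E (af P 0 v)))
    - dot (fdI (af P 0 u)) (Hy *m (IR2L *m feI E v))
    - 2 * dL * dot (fdI u) (Hy *m (IR2L *m (DxW P E *m v)))
    - 2 * sL * dot (EL P n m *m fdDI L u) (Hy *m (IR2L *m feI E v)).
Proof.
move=> eqL dsL.
have -> : HL L *m ut = RL P L *m u + HL L *m s
    + HL L *m SAT_IL P L E IR2L 2^-1 2^-1 dL sL u v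
    - HL L *m \sum_(k < 2) (invmx (HL L) *m QL L k *m af P k u
          + talpha P k *: (dF P k u *m (invmx (HL L) *m QL L k *m u))).
  rewrite -[ut](addrK (\sum_(k < 2) (invmx (HL L) *m QL L k *m af P k u
          + talpha P k *: (dF P k u *m (invmx (HL L) *m QL L k *m u))))) eqL.
  by rewrite mulmxBr !mulmxDr -!mulmxA mulKVmx ?HL_unit.
(* Multiplication by [HL] removes the inverse of [Hx] from the penalty and leaves the inner product
   of [Hy] on the line. *)
have lift a (c : 'cV[R]_n.+2) (q : 'cV[R]_m.+2) :
    dot u (HL L *m (a *: ((invmx Hx *m c) *t q : fdvec R n m)))
    = a * dot (rowx c^T *m u) (Hy *m q).
  rewrite -scalemxAr dotZr; congr (_ * _).
  have -> : HL L *m ((invmx Hx *m c) *t q : fdvec R n m) = c *t (Hy *m q).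
    have -> : c *t (Hy *m q) = (Hx *m (invmx Hx *m c)) *t (Hy *m q).
      by rewrite mulKVmx ?sbpH_unit.
       exact: (@tensmx_mul R _ _ _ _ 1 1 Hx Hy (invmx Hx *m c) q).
  by rewrite tens_col dotMr trmxK.
have sat : dot u (HL L *m SAT_IL P L E IR2L 2^-1 2^-1 dL sL u v) =
    2^-1 * dot (fdI u) (Hy *m (fdI (af P 0 u) - IR2L *m feI E (af P 0 v)))
    + 2^-1 * dot (fdI (af P 0 u)) (Hy *m (fdI u - IR2L *m feI E v))
    + dL * dot (fdI u) (Hy *m (EL P n m *m fdDI L u - IR2L *m (DxW P E *m v)))
    + sL * dot (EL P n m *m fdDI L u) (Hy *m (fdI u - IR2L *m feI E v)).
  (* The diagonal [Hy] passes the diagonal matrices [dF] and [EL], after which skew-symmetry applies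
     on the interface. *)
  have comm d (e : 'cV[R]_m.+2) : Hy *m (diag_mx d *m e) = diag_mx d *m (Hy *m e).
    by rewrite !mulmxA; congr (_ *m _); rewrite !mulmx_diag; congr diag_mx;
       apply/rowP => j; rewrite !mxE mulrC.
  rewrite /SAT_IL ![HL L *m (_ + _)]mulmxDr !dotDr !lift -/(fdI u) trmxK -/(fdDI L u).
  rewrite -![Hy *m (talpha _ _ *: _)]scalemxAr !dotZr /dF /EL !comm.
  rewrite -/(dF P 0 (fdI u)) -/(EL P n m).
  rewrite af_dF -fdI_af.
  by rewrite [dot (EL P n m *m _) _]dotMl /EL tr_diag_mx.
rewrite dotBr !dotDr sat fd_convection.
have := fd_diffusion P L u.
rewrite /fd_outer !formE !mulmxBr !dotBr -!scalemxAr !dotZr.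
have symH (x y : 'cV[R]_m.+2) : dot x (Hy *m y) = dot y (Hy *m x).
  by rewrite dotC dotMl sbpH_tr.
rewrite [dot (fdI (af _ _ _)) (Hy *m fdI u)]symH.
rewrite [dot (EL P n m *m _) (Hy *m fdI u)]symH.
(* With [sL] eliminated, the products of [dL] with inner products serve as atoms for linear
   arithmetic. *)
have -> : sL = - 1 - dL by lra.
lra.
Qed.

End Rate.

Section Rate.
Context {R : realType} {G : blocks R} (P : problem G) {n m N r : nat}.
Context (L : fd_block G n m) (E : fe_block G N r).
Context (IL2R : 'M[R]_(r, m.+2)) (IR2L : 'M[R]_(m.+2, r)).

Local Notation Hy := (sbpH (Sy L)).

(** The two halves of [wRM] are transposes of each other, so they give the same form, equal to that
    of the simplified term; [af_dF] then produces the flux. *)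
Lemma beta_termE c (u : fdvec R n m) (v : 'cV[R]_N) :
  dot v (beta_term P E IL2R c u v) =
  dot (feI E (af P 0 v)) (MI E *m (feI E v - IL2R *m fdI u)).
Proof.
case: c => /=; last first.
  by rewrite dotZr -[_ *m (LW E)^T *m _]mulmxA af_dF RM_LWT.
have wE : diag_mx (talpha P 0 *: map_mx (derive1 (flux P 0)) v)^T
    = talpha P 0 *: dF P 0 v.
  by apply/matrixP => i j; rewrite !mxE mulrnAr.
rewrite dotBr dotZr -[_ *m (LW E)^T *m _]mulmxA af_dF RM_LWT mulmxBr dotBr; congr (_ - _).
rewrite /wRM wE -[(2^-1 *: _) *m v]scalemxAl dotZr mulmxDl dotDr.
rewrite -[RM E West *m _ *m v]mulmxA -[_ *: dF P 0 v *m RM E West *m v]mulmxA.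
rewrite -[(_ *: dF P 0 v) *m v]scalemxAl talpha_dF.
rewrite -[(_ *: dF P 0 v) *m (_ *m v)]scalemxAl dotZr af_dF -RM_feI.
by rewrite [dot v _]dotC dotMl RM_tr; field.
Qed.

Lemma normal_outer k v w :
  dot v ((QR E k + (QR E k)^T) *m w) =
    normal R North k * dot v (RM E North *m w) + normal R East k * dot v (RM E East *m w)
    + normal R South k * dot v (RM E South *m w) + normal R West k * dot v (RM E West *m w).
Proof. by rewrite QR_sbp !mulmxDl !dotDr -!scalemxAl !dotZr. Qed.

Lemma MI_sym x y : dot x (MI E *m y) = dot y (MI E *m x).
Proof. by rewrite dotC dotMl MI_tr. Qed.

(** The mirror image of [fd_rate]: the outward normal at the interface is reversed, hence the
    weights minus one half and [dR + sR = 1]. The stiffness term is dropped by [AR_ge0]. *)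
Lemma fe_rate cp cb (u : fdvec R n m) (v vt s : 'cV[R]_N) dR sR :
  (cp = pointwise -> forall k, MR E *m dF P k v = dF P k v *m MR E) ->
  vt + \sum_(k < 2)
         (invmx (MR E) *m QR E k *m af P k v
          + talpha P k *: fe_dF_prod P E cp k v)
    = invmx (MR E) *m RR P E *m v + s
      + SAT_IR P L E IL2R cb (- 2^-1) (- 2^-1) dR sR u v ->
  dR + sR = 1 ->
  2 * dot v (MR E *m vt) <=
    fe_outer P E v + 2 * (v^T *m MR E *m s) 0 0
    + dot (feI E v) (MI E *m (IL2R *m fdI (af P 0 u)))
    + dot (feI E (af P 0 v)) (MI E *m (IL2R *m fdI u))
    - 2 * dR * dot (feI E v) (MI E *m (IL2R *m (EL P n m *m fdDI L u)))
    - 2 * sR * dot (DxW P E *m v) (MI E *m (IL2R *m fdI u)).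
Proof.
move=> comm eqR dsR.
have -> : MR E *m vt = RR P E *m v + MR E *m s
    + MR E *m SAT_IR P L E IL2R cb (- 2^-1) (- 2^-1) dR sR u v
    - MR E *m \sum_(k < 2) (invmx (MR E) *m QR E k *m af P k v
          + talpha P k *: fe_dF_prod P E cp k v).
  rewrite -[vt](addrK (\sum_(k < 2) (invmx (MR E) *m QR E k *m af P k v
          + talpha P k *: fe_dF_prod P E cp k v))) eqR.
  by rewrite mulmxBr 2!mulmxDr -[_ *m RR P E *m v]mulmxA mulKVmx ?MR_unit.
(* Transposition moves the boundary flux matrix onto [w], where it acts as the interface derivative
   [DxW]. *)
have rc w q : dot w ((- RC P E West)^T *m ((LW E)^T *m q)) =
    dot (DxW P E *m w) (MI E *m q).
  have -> : dot w ((- RC P E West)^T *m ((LW E)^T *m q)) =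
     - dot ((LW E)^T *m q) (RC P E West *m w).
    by rewrite dotMr trmxK mulNmx dotC dotNr.
  by rewrite RC_feI opprK /feI [LW E *m (_ *m _)]mulmxA LW_west mul1mx MI_sym.
have sat : dot v (MR E *m SAT_IR P L E IL2R cb (- 2^-1) (- 2^-1) dR sR u v) =
    - 2^-1 * dot (feI E v) (MI E *m (feI E (af P 0 v) - IL2R *m fdI (af P 0 u)))
    - 2^-1 * dot (feI E (af P 0 v)) (MI E *m (feI E v - IL2R *m fdI u))
    + dR * dot (feI E v) (MI E *m (DxW P E *m v - IL2R *m (EL P n m *m fdDI L u)))
    + sR * dot (DxW P E *m v) (MI E *m (feI E v - IL2R *m fdI u)).
  rewrite /SAT_IR ![MR E *m (_ + _)]mulmxDr !dotDr -![MR E *m (_ *: _)]scalemxAr.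
  have lift (K : 'M[R]_N) q : MR E *m (invmx (MR E) *m K *m (LW E)^T *m q)
      = K *m ((LW E)^T *m q) by rewrite -!mulmxA mulKVmx ?MR_unit.
  by rewrite !dotZr !lift mulKVmx ?MR_unit // beta_termE !RM_LWT rc !mulNr.
rewrite dotBr !dotDr sat fe_convection // sum2 !normal_outer.
have A0 := AR_ge0 E P v.
rewrite /RR mulmxDl mulNmx !mulmxDl !dotDr dotNr RC_feI.
rewrite /fe_outer /fe_outer_side !sum2 !formE !mulmxBr !dotBr /normal /= RM_feI.
rewrite [dot (feI E (af _ _ _)) (_ *m feI E v)]MI_sym [dot (DxW P E *m v) (_ *m feI E v)]MI_sym.
have -> : sR = 1 - dR by lra.
lra.
Qed.

Lemma coupled_rate p cp cb (u ut sL : fdvec R n m) (v vt sR : 'cV[R]_N) dL dR :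
  sbp_preserving L E IL2R IR2L p ->
  (cp = pointwise -> forall k, MR E *m dF P k v = dF P k v *m MR E) ->
  ut + \sum_(k < 2)
         (invmx (HL L) *m QL L k *m af P k u
          + talpha P k *: (dF P k u *m (invmx (HL L) *m QL L k *m u)))
    = invmx (HL L) *m RL P L *m u + sL
      + SAT_IL P L E IR2L 2^-1 2^-1 dL (- dR) u v ->
  vt + \sum_(k < 2)
         (invmx (MR E) *m QR E k *m af P k v
          + talpha P k *: fe_dF_prod P E cp k v)
    = invmx (MR E) *m RR P E *m v + sR
      + SAT_IR P L E IL2R cb (- 2^-1) (- 2^-1) dR (- dL) u v ->
  dL - dR = -1 ->
  2 * dot u (HL L *m ut) + 2 * dot v (MR E *m vt) <=
    (fd_outer P L u + 2 * (u^T *m HL L *m sL) 0 0)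
    + (fe_outer P E v + 2 * (v^T *m MR E *m sR) 0 0).
Proof.
move=> [_ _ pres] comm eqL eqR ds.
(* The SBP-preserving property makes the two interpolations adjoint for [MI] and [Hy]. The mixed
   terms of the two blocks become the same inner products with opposite signs. *)
have coupling x y : dot y (MI E *m (IL2R *m x)) = dot x (Hy *m (IR2L *m y)).
  rewrite [MI E *m _]mulmxA pres -mulmxA dotMr trmxK dotC.
  by rewrite dotMl sbpH_tr.
have := fd_rate _ _ _ _ _ _ _ _ _ _ eqL ds.
have ds' : dR - dL = 1 by lra.
have := fe_rate _ _ _ _ _ _ _ _ comm eqR ds'.
rewrite !coupling.
lra.
Qed.

End Rate.

(** * Time derivative of the energy and the stability estimate *)

Section EnergyDerivative.
Context {R : realType}.

(** The product rule, entry by entry, gives two double sums, which the symmetry of [H] makes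
    equal. *)
Lemma is_derive_dot q (H : 'M[R]_q) (w : R -> 'cV[R]_q) t :
  H^T = H -> derivable_at w t ->
  is_derive t 1 (fun s => dot (w s) (H *m w s)) (2 * dot (w t) (H *m ddt w t)).
Proof.
move=> Hs dw.
have wD i : is_derive t 1 (fun s => w s i 0) (ddt w t i 0).
  by rewrite mxE derive1E; apply/derivableP/dw.
have -> : (fun s => dot (w s) (H *m w s))
    = \sum_i \sum_j (fun s => H i j * (w s i 0 * w s j 0)).
  apply/funext => s; rewrite dotE fct_sumE; apply: eq_bigr => i _.
  by rewrite mxE fct_sumE mulr_sumr; apply: eq_bigr => j _; rewrite mulrCA.
have D : is_derive t 1 (\sum_i \sum_j (fun s => H i j * (w s i 0 * w s j 0)))
    (\sum_i \sum_j (H i j * (w t i 0 * ddt w t j 0 + w t j 0 * ddt w t i 0))).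
  apply: is_derive_sum => i; apply: is_derive_sum => j.
  exact: (is_deriveZ (H i j) (is_deriveM (wD i) (wD j))).
apply: (is_derive_eq D).
under eq_bigr do under eq_bigr do rewrite mulrDr.
under eq_bigr do rewrite big_split.
rewrite big_split /= mulrDl mul1r; congr (_ + _).
  rewrite dotE; apply: eq_bigr => i _; rewrite mxE mulr_sumr.
  by apply: eq_bigr => j _; rewrite mulrCA.
rewrite exchange_big /= dotE; apply: eq_bigr => i _; rewrite mxE mulr_sumr.
by apply: eq_bigr => j _; rewrite -[in LHS]Hs mxE mulrCA.
Qed.

End EnergyDerivative.

Theorem theorem3p7 (R : realType) (G : blocks R) (P : problem G)
    (n m : nat) (L : fd_block G n m) (N r : nat) (E : fe_block G N r)
    (p : nat) (IL2R : 'M[R]_(r, m.+2)) (IR2L : 'M[R]_(m.+2, r))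
    (SATL : fdvec R n m -> fdvec R n m) (SATR : 'cV[R]_N -> 'cV[R]_N)
    (cprod : fe_product) (cbeta : beta_form)
    (aL bL dL sL aR bR dR sR : R)
    (Tend : R) (u : R -> fdvec R n m) (v : R -> 'cV[R]_N)
    (hI : sbp_preserving L E IL2R IR2L p)
    (hproper : proper_outer P L E SATL SATR)
    (hu : forall t, 0 < t < Tend -> derivable_at u t)
    (hv : forall t, 0 < t < Tend -> derivable_at v t)
    (hcprod : cprod = pointwise -> forall t, 0 < t < Tend ->
       forall k, MR E *m dF P k (v t) = dF P k (v t) *m MR E)
    (eqL : forall t, 0 < t < Tend ->
       ddt u t
       + \sum_(k < 2)
           (invmx (HL L) *m QL L k *m af P k (u t)
            + talpha P k *:
                (dF P k (u t) *m (invmx (HL L) *m QL L k *m u t)))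
       = invmx (HL L) *m RL P L *m u t + SATL (u t)
         + SAT_IL P L E IR2L aL bL dL sL (u t) (v t))
    (eqR : forall t, 0 < t < Tend ->
       ddt v t
       + \sum_(k < 2)
           (invmx (MR E) *m QR E k *m af P k (v t)
            + talpha P k *: fe_dF_prod P E cprod k (v t))
       = invmx (MR E) *m RR P E *m v t + SATR (v t)
         + SAT_IR P L E IL2R cbeta aR bR dR sR (u t) (v t))
    (haL : aL = 2^-1) (hbL : bL = 2^-1)
    (haR : aR = - 2^-1) (hbR : bR = - 2^-1)
    (hdL : dL = - sR) (hsL : sL = - dR) (hdsL : dL + sL = -1) :
  forall t, 0 < t < Tend ->
    derivable (fun s => energy L E (u s) (v s)) t 1
    /\ derive1 (fun s => energy L E (u s) (v s)) t <= 0.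
Proof.
move=> t tT; subst aL bL aR bR sL.
have sRE : sR = - dL by rewrite hdL opprK.
have duL := is_derive_dot _ _ _ _ (HL_tr L) (hu t tT).
have dvR := is_derive_dot _ _ _ _ (MR_tr E) (hv t tT).
have dE : is_derive t 1 (fun s => energy L E (u s) (v s))
    (2 * dot (u t) (HL L *m ddt u t) + 2 * dot (v t) (MR E *m ddt v t)).
  have -> : (fun s => energy L E (u s) (v s)) =
      (fun s => dot (u s) (HL L *m u s)) + (fun s => dot (v s) (MR E *m v s)).
    by apply/funext => s; rewrite /energy !formE.
  exact: is_deriveD.
split; first exact: ex_derive.
(* The outer terms at time [t] are nonpositive by [hproper], so it suffices to bound the rate by
   them. *)
rewrite derive1E derive_val; apply: le_trans (hproper (u t) (v t)).
have eqRt := eqR t tT; rewrite sRE in eqRt.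
apply: (coupled_rate _ _ _ _ _ _ _ _ _ _ _ _ _ _ _ _ hI _ (eqL t tT) eqRt hdsL).
by move=> cE; exact: (hcprod cE t tT).
Qed.
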